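(* Each three-dimensional solvable subalgebra of $\mathfrak{sp}(4,\mathbb{C})$ which contains a regular semisimple element but not a Cartan subalgebra is conjugate to one of the following: $$\langle T_{a,1},X_{\alpha},X_{\alpha+\beta}\rangle,\quad a\neq0,\pm1;$$ $$\langle T_{a,1},X_{\alpha},X_{\alpha+2\beta}\rangle\sim\langle T_{a^{-1},1},X_{\alpha},X_{\alpha+2\beta}\rangle,\quad a\neq 0,\pm1;$$ $$\langle T_{3,1},X_{\alpha}+X_{\beta},X_{\alpha+2\beta}\rangle .$$ Apart from the equivalences noted, the algebras listed above are pairwise inequivalent.
   Context: Let $J=\begin{pmatrix}0&0&1&0\\0&0&0&1\\-1&0&0&0\\0&-1&0&0\end{pmatrix}$. $\mathfrak{sp}(4,\mathbb{C})$ is the Lie algebra of $4\times4$ complex matrices $X$ with $JX^tJ=X$, and $Sp(4,\mathbb{C})=\{g\in GL(4,\mathbb{C}) : gJg^t=J\}$, acting on $\mathfrak{sp}(4,\mathbb{C})$ by conjugation $X\mapsto gXg^{-1}$. For $a,b\in\mathbb{C}$, $T_{a,b}=\mathrm{diag}(a,b,-a,-b)$. A Cartan subalgebra of $\mathfrak{sp}(4,\mathbb{C})$ is a two-dimensional subalgebra of commuting semisimple (diagonalizable) elements. A semisimple element of $\mathfrak{sp}(4,\mathbb{C})$ is regular if it has four distinct eigenvalues; $T_{a,b}$ is regular iff $a,b\neq0$ and $a\neq\pm b$. With $E_{ij}$ the matrix units, $X_\alpha=E_{24}$, $X_\beta=E_{12}-E_{43}$, $X_{\alpha+\beta}=E_{14}+E_{23}$,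 $X_{\alpha+2\beta}=E_{13}$. $\langle\,\cdot\,\rangle$ denotes the complex linear span. Two subalgebras are equivalent (conjugate), written $\sim$, if some $g\in Sp(4,\mathbb{C})$ conjugates one onto the other. *)

(* Defs.v *)
From HB Require Import structures.
From mathcomp Require Import all_boot all_order all_algebra.
From mathcomp Require Import reals complex.

Set Implicit Arguments.
Unset Strict Implicit.
Unset Printing Implicit Defensive.

Import GRing.Theory.
Local Open Scope ring_scope.

Section Sp4.
Variable F : fieldType.
Implicit Types (X Y Z g : 'M[F]_4) (s t h : {vspace 'M[F]_4}).

(* Row and column indices are 1-based here, as in the usual E_ij. *)
Definition Eunit (i j : nat) : 'M[F]_4 :=
  \matrix_(k, l) ((k.+1 == i) && (l.+1 == j))%:R.

Definition J4 : 'M[F]_4 := Eunit 1 3 + Eunit 2 4 - Eunit 3 1 - Eunit 4 2.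

Definition in_sp4 X : Prop := J4 *m X^T *m J4 = X.

Definition in_Sp4 g : Prop := g \in unitmx /\ g *m J4 *m g^T = J4.

Definition lie_bracket X Y : 'M[F]_4 := X *m Y - Y *m X.

Definition sp4_subalgebra s : Prop :=
  (forall X, X \in s -> in_sp4 X) /\
  (forall X Y, X \in s -> Y \in s -> lie_bracket X Y \in s).

(* By bilinearity the brackets of basis vectors span [s, s];
   see derived_algebra_subP. *)
Definition derived_algebra s : {vspace 'M[F]_4} :=
  <<[seq lie_bracket X Y | X <- vbasis s, Y <- vbasis s]>>%VS.

Definition lie_solvable s : Prop :=
  exists n, iter n derived_algebra s = 0%VS.

Definition regular_semisimple X : Prop :=
  diagonalizable X /\
  exists ev : seq F, [/\ size ev = 4%N, uniq ev & all (eigenvalue X) ev].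

Definition cartan_subalgebra h : Prop :=
  [/\ sp4_subalgebra h, \dim h = 2%N,
      forall X Y, X \in h -> Y \in h -> lie_bracket X Y = 0
    & forall X, X \in h -> diagonalizable X].

Definition conj_end g : 'End('M[F]_4) :=
  linfun (mulmxr (invmx g) \o mulmx g).

Definition Sp4_conjugate s t : Prop :=
  exists g, in_Sp4 g /\ (conj_end g @: s)%VS = t.

Definition Tdiag (a b : F) : 'M[F]_4 :=
  diag_mx (\row_(k < 4) [:: a; b; - a; - b]`_k).

Definition Xalpha : 'M[F]_4 := Eunit 2 4.
Definition Xbeta : 'M[F]_4 := Eunit 1 2 - Eunit 4 3.
Definition Xalpha_beta : 'M[F]_4 := Eunit 1 4 + Eunit 2 3.
Definition Xalpha_2beta : 'M[F]_4 := Eunit 1 3.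

Definition span3 X Y Z : {vspace 'M[F]_4} := <<[:: X; Y; Z]>>%VS.

Definition fam_short (a : F) : {vspace 'M[F]_4} :=
  span3 (Tdiag a 1) Xalpha Xalpha_beta.
Definition fam_long (a : F) : {vspace 'M[F]_4} :=
  span3 (Tdiag a 1) Xalpha Xalpha_2beta.
Definition alg_principal : {vspace 'M[F]_4} :=
  span3 (Tdiag 3%:R 1) (Xalpha + Xbeta) Xalpha_2beta.

Definition admissible (a : F) : Prop := [/\ a <> 0, a <> 1 & a <> -1].

Lemma conj_endE g X : conj_end g X = g *m X *m invmx g.
Proof. by rewrite lfunE. Qed.

Lemma derived_algebra_subP s t :
  (derived_algebra s <= t)%VS <->
  (forall X Y, X \in s -> Y \in s -> lie_bracket X Y \in t).
Proof.
split=> [/span_subvP sub X Y sX sY|sub]; last first.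
  apply/span_subvP => _ /allpairsP[[X Y] /= [sX sY ->]].
  by apply: sub; apply: vbasis_mem.
rewrite (coord_vbasis sX) (coord_vbasis sY) /lie_bracket.
rewrite mulmx_suml mulmx_sumr -sumrB; apply: memv_suml => i _.
rewrite mulmx_sumr mulmx_suml -sumrB; apply: memv_suml => j _.
rewrite -!scalemxAl -!scalemxAr !scalerA [_ * coord _ i X]mulrC -scalerBr.
by apply/memvZ/sub/allpairsP; exists ((vbasis s)`_i, (vbasis s)`_j);
  rewrite !mem_nth ?size_tuple.
Qed.

End Sp4.

(* Main.v *)
(* Conjugate a regular element of s to a diagonal T = T_{a,b}: since X J is
   symmetric, the form J pairs each eigenspace of X with the opposite one only, so
   rescaled eigenvectors form a symplectic basis. Then s is stable under ad T,
   hence is the sum of its weight components; as s contains no Cartan subalgebra,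
   its zero weight component is <T>, and s = <T, Y, Z> with Y, Z of nonzero
   weights. By Jacobi [Y, Z] has the sum of the weights, so it lies in <T>, and
   it vanishes because s is solvable. Now Y and Z are commuting combinations of
   root vectors. The Weyl group moves a long root in the support of Y or Z to alpha
   (without long roots Y and Z cannot commute), and the weight and commutation
   equations leave the listed possibilities; mixed root vectors occur only for
   a = 3b up to the Weyl group.

   For the inequivalences, compare the weights of the elements of rank one: they
   form two lines with distinct weights in the long family, and a single line in
   the short family and in the principal algebra. Finally X_alpha + X_beta has
   weight 2 and nonzero square, while all vectors of weight 2 in the short family
   square to zero. *)
Require Import Defs.
From mathcomp Require Import all_boot all_order all_algebra.
From mathcomp Require Import reals complex.
From mathcomp Require Import ring.
Import GRing.Theory Num.Theory.
Local Open Scope ring_scope.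

Set Implicit Arguments.
Unset Strict Implicit.
Unset Printing Implicit Defensive.

(** * Four by four matrices as explicit lists of entries *)

Section Mx4.
Variable F : comNzRingType.
Implicit Types (s t : seq F) (A : 'M[F]_4).

(** Row-major list of the sixteen entries. With concrete lists, a matrix identity becomes by
    computation one scalar identity per entry. *)
Definition mx4 s : 'M[F]_4 := \matrix_(i, j) s`_(4 * i + j).

Lemma mx4_inj s t : size s = 16%N -> size t = 16%N -> mx4 s = mx4 t -> s = t.
Proof.
move=> ss st E; apply: (@eq_from_nth _ 0); rewrite ?ss // => k k16.
have k4 : (k %/ 4 < 4)%N by rewrite ltn_divLR.
have k4' : (k %% 4 < 4)%N by rewrite ltn_mod.
move/matrixP: E => /(_ (Ordinal k4) (Ordinal k4')).
by rewrite !mxE /= mulnC -divn_eq.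
Qed.

Lemma mx4P A : exists2 s, size s = 16%N & A = mx4 s.
Proof.
exists [seq A (inord (k %/ 4)) (inord (k %% 4)) | k <- iota 0 16].
  by rewrite size_map.
apply/matrixP => i j; have ij16 : (4 * i + j < 16)%N.
  by case: i j => [] [|[|[|[|i]]]] //= hi [] [|[|[|[|j]]]].
rewrite mxE (nth_map 0%N) ?size_iota // nth_iota // add0n mulnC.
by rewrite divnMDl // modnMDl divn_small // modn_small // addn0 !inord_val.
Qed.

(** The lengths must agree because [zip] truncates; past the common end every entry is the default
    0. *)
Lemma add_mx4 s t : size s = size t ->
  mx4 s + mx4 t = mx4 [seq x.1 + x.2 | x <- zip s t].
Proof.
move=> st; apply/matrixP => i j; rewrite !mxE.
have szt : size [seq x.1 + x.2 | x <- zip s t] = size s.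
  by rewrite size_map size_zip st minnn.
case: (ltnP (4 * i + j) (size s)) => h.
  by rewrite (nth_map 0) ?size_zip -?st ?minnn // nth_zip.
by rewrite !nth_default ?addr0 ?szt -?st.
Qed.

Lemma opp_mx4 s : - mx4 s = mx4 [seq - x | x <- s].
Proof.
apply/matrixP => i j; rewrite !mxE; case: (ltnP (4 * i + j) (size s)) => h.
  by rewrite (nth_map 0).
by rewrite !nth_default ?oppr0 ?size_map.
Qed.

Lemma scale_mx4 c s : c *: mx4 s = mx4 [seq c * x | x <- s].
Proof.
apply/matrixP => i j; rewrite !mxE; case: (ltnP (4 * i + j) (size s)) => h.
  by rewrite (nth_map 0).
by rewrite !nth_default ?mulr0 ?size_map.
Qed.

(** Position k stands for row [k %/ 4] and column [k %% 4], so the right side evaluates on concrete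
    lists. *)
Lemma mul_mx4 s t : mx4 s *m mx4 t =
  mx4 [seq s`_(4 * (k %/ 4)) * t`_(k %% 4) + s`_(4 * (k %/ 4) + 1) * t`_(4 + k %% 4)
        + s`_(4 * (k %/ 4) + 2) * t`_(8 + k %% 4)
        + s`_(4 * (k %/ 4) + 3) * t`_(12 + k %% 4) | k <- iota 0 16].
Proof.
apply/matrixP => i j; rewrite !mxE !big_ord_recr big_ord0 /= !mxE /= add0r addn0.
by case: i j => [] [|[|[|[|i]]]] //= hi [] [|[|[|[|j]]]].
Qed.

Lemma tr_mx4 s : (mx4 s)^T = mx4 [seq s`_(4 * (k %% 4) + k %/ 4) | k <- iota 0 16].
Proof.
apply/matrixP => i j; rewrite !mxE.
by case: i j => [] [|[|[|[|i]]]] //= hi [] [|[|[|[|j]]]].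
Qed.

Lemma scalar_mx4 c :
  c%:M = mx4 [:: c; 0; 0; 0;  0; c; 0; 0;  0; 0; c; 0;  0; 0; 0; c].
Proof.
apply/matrixP => i j; rewrite !mxE.
by case: i j => [] [|[|[|[|i]]]] //= hi [] [|[|[|[|j]]]].
Qed.

Lemma eq_cons (x y : F) s t : x = y -> s = t -> x :: s = y :: t.
Proof. by move=> -> ->. Qed.

End Mx4.

Ltac mx4_entries :=
  let i := fresh in let j := fresh in apply/matrixP => i j; rewrite !mxE;
  by case: i j => [] [|[|[|[|?]]]] //= ? [] [|[|[|[|?]]]] //= ?;
     rewrite ?(subr0, addr0, add0r, oppr0).

(** Brings matrix expressions to explicit lists; [mx4_ring] then compares the lists entry by
    entry. *)
Ltac mx4_simpl :=
  rewrite /lie_bracket ?scalar_mx4 !(mul_mx4, add_mx4, opp_mx4, scale_mx4, tr_mx4) //=;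
  rewrite ?divn_small.
Ltac mx4_ring :=
  mx4_simpl; apply: congr1; do ! (apply: eq_cons; first by ring).

(** * Coordinates on the symplectic Lie algebra *)

Section Basics.
Variable F : numFieldType.
Implicit Types (X Y Z g : 'M[F]_4) (s t : {vspace 'M[F]_4}) (a b c : F).

Lemma J4E : J4 F = mx4 [:: 0; 0; 1; 0;  0; 0; 0; 1;  -1; 0; 0; 0;  0; -1; 0; 0].
Proof. mx4_entries. Qed.

(* Cartan part (a, b); then the coordinates on the roots
   beta, -beta, alpha + 2 beta, alpha + beta, alpha,
   -(alpha + 2 beta), -(alpha + beta), -alpha, in this order. *)
Definition sp4mx a b (x y p q r u v w : F) : 'M[F]_4 :=
  mx4 [:: a; x; p; q;  y; b; q; r;  u; v; - a; - y;  v; w; - x; - b].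

Lemma TdiagE a b : Tdiag a b = sp4mx a b 0 0 0 0 0 0 0 0.
Proof. mx4_entries. Qed.

Lemma XalphaE : Xalpha F = sp4mx 0 0 0 0 0 0 1 0 0 0.
Proof. mx4_entries. Qed.

Lemma XbetaE : Xbeta F = sp4mx 0 0 1 0 0 0 0 0 0 0.
Proof. mx4_entries. Qed.

Lemma Xalpha_betaE : Xalpha_beta F = sp4mx 0 0 0 0 0 1 0 0 0 0.
Proof. mx4_entries. Qed.

Lemma Xalpha_2betaE : Xalpha_2beta F = sp4mx 0 0 0 0 1 0 0 0 0 0.
Proof. mx4_entries. Qed.

Definition root_vectorsE := (XalphaE, XbetaE, Xalpha_betaE, Xalpha_2betaE).

(** In 2 by 2 blocks the condition says that X has rows (A, B) and (C, -A^t) with B and C symmetric,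
    which leaves ten free parameters. *)
Lemma in_sp4P X : in_sp4 X <->
  exists a b x y p q r u v w, X = sp4mx a b x y p q r u v w.
Proof.
split=> [|[a [b [x [y [p [q [r [u [v [w ->]]]]]]]]]]]; last first.
  by rewrite /in_sp4 J4E /sp4mx; mx4_ring.
have [s] := mx4P X.
case: s => [|x1 [|x2 [|x3 [|x4 [|x5 [|x6 [|x7 [|x8 [|x9 [|x10 [|x11 [|x12
  [|x13 [|x14 [|x15 [|x16 [|? ?]]]]]]]]]]]]]]]]] // _ ->.
rewrite /in_sp4 J4E; mx4_simpl => /mx4_inj; do 2![move/(_ erefl)] => -[].
rewrite !(mul0r, mul1r, mulr0, mulr1, add0r, addr0, mulN1r, mulrN1, opprK).
move=> *; exists x1, x6, x2, x5, x3, x4, x8, x9, x10, x14.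
rewrite /sp4mx; apply: congr1. do !apply: eq_cons => //; congruence.
Qed.

Lemma J4_sqr : J4 F *m J4 F = - 1%:M.
Proof. by rewrite J4E; mx4_ring. Qed.

End Basics.

(** * Symplectic conjugation of matrices and of spans *)

Section Conjugacy.
Variable F : numFieldType.
Implicit Types (X Y Z g h : 'M[F]_4) (s t w : {vspace 'M[F]_4}) (a b c : F).

(** Since J^2 = -1, the matrix -(J g^t J) is a right inverse of g. *)
Lemma mulmx_J4_unit g : g *m J4 F *m g^T = J4 F -> in_Sp4 g.
Proof.
move=> gJ; split=> //; have /mulmx1_unit[] // : g *m - (J4 F *m g^T *m J4 F) = 1%:M.
by rewrite mulmxN !mulmxA gJ J4_sqr opprK.
Qed.

Lemma in_Sp4_mul g h : in_Sp4 g -> in_Sp4 h -> in_Sp4 (g *m h).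
Proof.
move=> [_ gJ] [_ hJ]; apply: mulmx_J4_unit.
by rewrite trmx_mul !mulmxA -(mulmxA g h) -(mulmxA g _ h^T) hJ.
Qed.

Lemma in_Sp4_inv g : in_Sp4 g -> in_Sp4 (invmx g).
Proof.
move=> [gu gJ]; apply: mulmx_J4_unit; rewrite -{1}gJ trmx_inv !mulmxA.
by rewrite mulVmx // mul1mx mulmxK // unitmx_tr.
Qed.

(** Conjugates are computed through g X = Y g, which avoids evaluating the inverse of an explicit
    matrix. *)
Lemma conj_end_intertwine g X Y :
  in_Sp4 g -> g *m X = Y *m g -> conj_end g X = Y.
Proof. by move=> [gu _] gX; rewrite conj_endE gX mulmxK. Qed.

Lemma conj_end_mul g h X : in_Sp4 g -> in_Sp4 h ->
  conj_end (g *m h) X = conj_end g (conj_end h X).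
Proof.
move=> Sg Sh; apply: conj_end_intertwine; first exact: in_Sp4_mul.
by case: Sg Sh => [gu _] [hu _]; rewrite !conj_endE !mulmxA !mulmxKV.
Qed.

Lemma Sp4_conjugate_trans t s w :
  Sp4_conjugate s t -> Sp4_conjugate t w -> Sp4_conjugate s w.
Proof.
move=> [g [Sg gs]] [h [Sh ht]]; exists (h *m g); split; first exact: in_Sp4_mul.
rewrite -ht -gs -limg_comp; apply: eq_in_limg => X _.
by rewrite comp_lfunE /= conj_end_mul.
Qed.

Lemma limg_conjK g s : in_Sp4 g ->
  (conj_end (invmx g) @: (conj_end g @: s))%VS = s.
Proof.
move=> Sg; rewrite -limg_comp -[RHS]lim1g; apply: eq_in_limg => X _.
rewrite comp_lfunE /= -conj_end_mul //; last exact: in_Sp4_inv.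
by rewrite mulVmx ?conj_endE ?invmx1 ?mul1mx ?mulmx1 ?id_lfunE //; case: Sg.
Qed.

Lemma Sp4_conjugate_sym s t : Sp4_conjugate s t -> Sp4_conjugate t s.
Proof.
move=> [g [Sg <-]]; exists (invmx g); split; first exact: in_Sp4_inv.
exact: limg_conjK.
Qed.

Lemma conj_end_bracket g X Y : in_Sp4 g ->
  conj_end g (lie_bracket X Y) = lie_bracket (conj_end g X) (conj_end g Y).
Proof.
move=> [gu _]; rewrite !conj_endE /lie_bracket mulmxBr mulmxBl !mulmxA.
by rewrite !(mulmxKV gu).
Qed.

Lemma Sp4_conjugate_span3 g X Y Z :
  in_Sp4 g -> Sp4_conjugate (span3 X Y Z)
    (span3 (conj_end g X) (conj_end g Y) (conj_end g Z)).
Proof. by move=> Sg; exists g; rewrite limg_span. Qed.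

Lemma memv_span3 X Y Z A :
  A \in span3 X Y Z -> exists c k l, A = c *: X + k *: Y + l *: Z.
Proof.
rewrite /span3 !span_cons span_nil addv0 => /memv_addP[_ /vlineP[c ->]].
move=> [_ /memv_addP[_ /vlineP[k ->] [_ /vlineP[l ->] ->]] ->].
by exists c, k, l; rewrite addrA.
Qed.

Lemma span3_scale X Y Z c k l : c != 0 -> k != 0 -> l != 0 ->
  span3 (c *: X) (k *: Y) (l *: Z) = span3 X Y Z.
Proof.
move=> c0 k0 l0; rewrite /span3 !span_cons span_nil.
have vlineZ m A : m != 0 -> (<[m *: A]> = <[A]>)%VS.
  move=> m0; apply/eqP; rewrite eqEsubv -!memvE memvZ ?memv_line //=.
  by rewrite -[A in A \in _](scalerK m0) memvZ ?memv_line.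
by rewrite !vlineZ.
Qed.

Lemma span3C X Y Z : span3 X Z Y = span3 X Y Z.
Proof.
by rewrite /span3 !span_cons span_nil !addv0; congr (_ + _)%VS; apply: addvC.
Qed.

End Conjugacy.

(** * Commuting weight vectors and the action of the Weyl group *)

Section CommutingRootVectors.
Variable F : numFieldType.
Implicit Types (X Y Z g h : 'M[F]_4) (s t : {vspace 'M[F]_4}) (a b c k l m : F).

Lemma in_sp4_conj g X : in_Sp4 g -> in_sp4 X -> in_sp4 (conj_end g X).
Proof.
move=> [gu gJ] spX; rewrite /in_sp4 conj_endE !trmx_mul trmx_inv.
(* The relation g J g^t = J is rewritten in two ways that move J past g and its transpose. *)
have JgT : J4 F *m invmx g^T = g *m J4 F.
  by rewrite -{1}gJ mulmxK ?unitmx_tr.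
have gTJ : g^T *m J4 F = J4 F *m invmx g.
  have J_unit : J4 F \in unitmx.
    by have /mulmx1_unit[] : J4 F *m - J4 F = 1%:M by rewrite mulmxN J4_sqr opprK.
  apply: (can_inj (mulKmx J_unit)); apply: (can_inj (mulKmx gu)).
  rewrite !mulmxA gJ J4_sqr -(mulmxA g) J4_sqr mulmxN mulmx1 mulNmx mulmxV //.
by rewrite !mulmxA JgT -(mulmxA _ g^T) gTJ -[in RHS]spX !mulmxA.
Qed.

Definition regular_pair a b : Prop := [/\ a != 0, b != 0, a != b & a != - b].

(** The data that the structure theory leaves beside T_{a,b}: two commuting vectors of nonzero
    weight. The last clause is their linear independence. *)
Definition commuting_eigenvectors a b Y Z : Prop :=
  [/\ in_sp4 Y /\ in_sp4 Z,
      exists2 l : F, l != 0 & lie_bracket (Tdiag a b) Y = l *: Y,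
      exists2 m : F, m != 0 & lie_bracket (Tdiag a b) Z = m *: Z,
      lie_bracket Y Z = 0
    & forall c k, c *: Y + k *: Z = 0 -> c = 0 /\ k = 0].

Lemma commuting_eigenvectorsC a b Y Z :
  commuting_eigenvectors a b Y Z -> commuting_eigenvectors a b Z Y.
Proof.
move=> [[spY spZ] lY mZ YZ free]; split=> // [|c k /esym].
  by rewrite /lie_bracket -opprB -/(lie_bracket Y Z) YZ oppr0.
by rewrite addrC => /esym/free[].
Qed.

Lemma commuting_eigenvectors_conj a b a' b' g Y Z Y' Z' :
  in_Sp4 g -> g *m Tdiag a b = Tdiag a' b' *m g ->
  g *m Y = Y' *m g -> g *m Z = Z' *m g ->
  commuting_eigenvectors a b Y Z ->
  commuting_eigenvectors a' b' Y' Z' /\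
  Sp4_conjugate (span3 (Tdiag a b) Y Z) (span3 (Tdiag a' b') Y' Z').
Proof.
move=> Sg /(conj_end_intertwine Sg) gT /(conj_end_intertwine Sg) <-.
move=> /(conj_end_intertwine Sg) <- [[spY spZ] [l l0 lY] [m m0 mZ] YZ free].
split; last by rewrite -gT; apply: Sp4_conjugate_span3.
split.
- by split; apply: in_sp4_conj.
- by exists l; rewrite // -gT -conj_end_bracket // lY linearZ.
- by exists m; rewrite // -gT -conj_end_bracket // mZ linearZ.
- by rewrite -conj_end_bracket // YZ linear0.
move=> c k; rewrite -!linearZ -linearD => /(congr1 (conj_end (invmx g))).
rewrite linear0 -conj_end_mul //; last exact: in_Sp4_inv.
have gu : g \in unitmx by case: Sg.
by rewrite mulVmx // conj_endE invmx1 mul1mx mulmx1 => /free.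
Qed.

Definition classified s : Prop :=
  [\/ exists a, admissible a /\ Sp4_conjugate s (fam_short a),
      exists a, admissible a /\ Sp4_conjugate s (fam_long a)
    | Sp4_conjugate s (alg_principal F)].

Lemma classified_conj s t : Sp4_conjugate s t -> classified t -> classified s.
Proof.
move=> st [[a [adm ta]]|[a [adm ta]]|tp].
- by constructor 1; exists a; split=> //; apply: Sp4_conjugate_trans ta.
- by constructor 2; exists a; split=> //; apply: Sp4_conjugate_trans ta.
- by constructor 3; apply: Sp4_conjugate_trans tp.
Qed.

(** Symplectic representatives of Weyl group elements: the exchange of a and b, and the sign changes
    of a and of b. *)
Definition weyl_swap : 'M[F]_4 :=
  mx4 [:: 0; 1; 0; 0;  1; 0; 0; 0;  0; 0; 0; 1;  0; 0; 1; 0].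
Definition weyl_flip1 : 'M[F]_4 :=
  mx4 [:: 0; 0; 1; 0;  0; 1; 0; 0;  -1; 0; 0; 0;  0; 0; 0; 1].
Definition weyl_flip2 : 'M[F]_4 :=
  mx4 [:: 1; 0; 0; 0;  0; 0; 0; 1;  0; 0; 1; 0;  0; -1; 0; 0].

Lemma weyl_swapP : in_Sp4 weyl_swap.
Proof. by apply: mulmx_J4_unit; rewrite J4E /weyl_swap; mx4_ring. Qed.
Lemma weyl_flip1P : in_Sp4 weyl_flip1.
Proof. by apply: mulmx_J4_unit; rewrite J4E /weyl_flip1; mx4_ring. Qed.
Lemma weyl_flip2P : in_Sp4 weyl_flip2.
Proof. by apply: mulmx_J4_unit; rewrite J4E /weyl_flip2; mx4_ring. Qed.

Lemma weyl_swapE a b x y p q r u v w :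
  weyl_swap *m sp4mx a b x y p q r u v w =
  sp4mx b a y x r q p w v u *m weyl_swap.
Proof. by rewrite /weyl_swap /sp4mx; mx4_ring. Qed.
Lemma weyl_flip1E a b x y p q r u v w :
  weyl_flip1 *m sp4mx a b x y p q r u v w =
  sp4mx (- a) b v q (- u) (- y) r (- p) (- x) w *m weyl_flip1.
Proof. by rewrite /weyl_flip1 /sp4mx; mx4_ring. Qed.
Lemma weyl_flip2E a b x y p q r u v w :
  weyl_flip2 *m sp4mx a b x y p q r u v w =
  sp4mx a (- b) q v p (- x) (- w) u (- y) (- r) *m weyl_flip2.
Proof. by rewrite /weyl_flip2 /sp4mx; mx4_ring. Qed.

Notation rootmx := (sp4mx 0 0).

(** Stated as a continuation, so that applying it replaces a goal by its image under g and carries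
    the hypotheses on Y and Z along. *)
Lemma classified_pair_conj a b a' b' g Y Z Y' Z' :
  in_Sp4 g -> commuting_eigenvectors a b Y Z ->
  g *m Tdiag a b = Tdiag a' b' *m g -> g *m Y = Y' *m g -> g *m Z = Z' *m g ->
  (commuting_eigenvectors a' b' Y' Z' -> classified (span3 (Tdiag a' b') Y' Z')) ->
  classified (span3 (Tdiag a b) Y Z).
Proof.
move=> Sg YZ gT gY gZ cl.
have [YZ' st] := commuting_eigenvectors_conj Sg gT gY gZ YZ.
by apply: classified_conj st _; apply: cl.
Qed.

Lemma weyl_swap_pair a b x y p q r u v w x' y' p' q' r' u' v' w' :
  let Y := rootmx x y p q r u v w in
  let Z := rootmx x' y' p' q' r' u' v' w' in
  let Y' := rootmx y x r q p w v u in
  let Z' := rootmx y' x' r' q' p' w' v' u' in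
  commuting_eigenvectors a b Y Z ->
  (commuting_eigenvectors b a Y' Z' -> classified (span3 (Tdiag b a) Y' Z')) ->
  classified (span3 (Tdiag a b) Y Z).
Proof.
move=> Y Z Y' Z' YZ; apply: (classified_pair_conj weyl_swapP YZ).
- by rewrite !TdiagE weyl_swapE ?oppr0.
- by rewrite weyl_swapE ?oppr0.
- by rewrite weyl_swapE ?oppr0.
Qed.

Lemma weyl_flip1_pair a b x y p q r u v w x' y' p' q' r' u' v' w' :
  let Y := rootmx x y p q r u v w in
  let Z := rootmx x' y' p' q' r' u' v' w' in
  let Y' := rootmx v q (- u) (- y) r (- p) (- x) w in
  let Z' := rootmx v' q' (- u') (- y') r' (- p') (- x') w' in
  commuting_eigenvectors a b Y Z ->
  (commuting_eigenvectors (- a) b Y' Z' -> classified (span3 (Tdiag (- a) b) Y' Z')) ->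
  classified (span3 (Tdiag a b) Y Z).
Proof.
move=> Y Z Y' Z' YZ; apply: (classified_pair_conj weyl_flip1P YZ).
- by rewrite !TdiagE weyl_flip1E ?oppr0.
- by rewrite weyl_flip1E ?oppr0.
- by rewrite weyl_flip1E ?oppr0.
Qed.

Lemma weyl_flip2_pair a b x y p q r u v w x' y' p' q' r' u' v' w' :
  let Y := rootmx x y p q r u v w in
  let Z := rootmx x' y' p' q' r' u' v' w' in
  let Y' := rootmx q v p (- x) (- w) u (- y) (- r) in
  let Z' := rootmx q' v' p' (- x') (- w') u' (- y') (- r') in
  commuting_eigenvectors a b Y Z ->
  (commuting_eigenvectors a (- b) Y' Z' -> classified (span3 (Tdiag a (- b)) Y' Z')) ->
  classified (span3 (Tdiag a b) Y Z).
Proof.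
move=> Y Z Y' Z' YZ; apply: (classified_pair_conj weyl_flip2P YZ).
- by rewrite !TdiagE weyl_flip2E ?oppr0.
- by rewrite weyl_flip2E ?oppr0.
- by rewrite weyl_flip2E ?oppr0.
Qed.

End CommutingRootVectors.

(** * Weight and commutation equations, and recognition of the listed algebras *)

Section Classification.
Variable F : numFieldType.
Implicit Types (X Y Z g h : 'M[F]_4) (s t : {vspace 'M[F]_4}) (a b c k l m : F).
Implicit Types x y p q r u v w : F.

Notation rootmx := (sp4mx 0 0).

Lemma sp4mx_inj a b x y p q r u v w a' b' x' y' p' q' r' u' v' w' :
  sp4mx a b x y p q r u v w = sp4mx a' b' x' y' p' q' r' u' v' w' :> 'M[F]_4 ->
  [:: a; b; x; y; p; q; r; u; v; w] = [:: a'; b'; x'; y'; p'; q'; r'; u'; v'; w'].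
Proof.
move/mx4_inj => /(_ erefl erefl)[<- <- <- <- <- <- _ <- <- <- _ _ _ <- _ _].
by [].
Qed.

Lemma scale_sp4mx c a b x y p q r u v w :
  c *: sp4mx a b x y p q r u v w = sp4mx (c * a) (c * b)
    (c * x) (c * y) (c * p) (c * q) (c * r) (c * u) (c * v) (c * w) :> 'M[F]_4.
Proof. by rewrite /sp4mx; mx4_ring. Qed.

Lemma add_sp4mx a b x y p q r u v w a' b' x' y' p' q' r' u' v' w' :
  sp4mx a b x y p q r u v w + sp4mx a' b' x' y' p' q' r' u' v' w' =
  sp4mx (a + a') (b + b') (x + x') (y + y') (p + p') (q + q') (r + r')
    (u + u') (v + v') (w + w') :> 'M[F]_4.
Proof. by rewrite /sp4mx; mx4_ring. Qed.

Lemma sp4mx0 : sp4mx 0 0 0 0 0 0 0 0 0 0 = 0 :> 'M[F]_4.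
Proof. by rewrite -[RHS](scale0r (sp4mx 0 0 0 0 0 0 0 0 0 0)) scale_sp4mx !mul0r. Qed.

(** The coefficients are the eight roots evaluated at T_{a,b}; the Cartan coordinates are killed. *)
Lemma Tdiag_bracket a b c k x y p q r u v w :
  lie_bracket (Tdiag a b) (sp4mx c k x y p q r u v w) =
  rootmx ((a - b) * x) ((b - a) * y) (2 * a * p) ((a + b) * q) (2 * b * r)
    (- (2 * a) * u) (- (a + b) * v) (- (2 * b) * w).
Proof. by rewrite TdiagE /sp4mx; mx4_ring. Qed.

Lemma root_bracket x y p q r u v w x' y' p' q' r' u' v' w' :
  lie_bracket (rootmx x y p q r u v w) (rootmx x' y' p' q' r' u' v' w') =
  sp4mx (x * y' - x' * y + p * u' - p' * u + q * v' - q' * v)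
    (y * x' - y' * x + q * v' - q' * v + r * w' - r' * w)
    (p * v' + q * w' - p' * v - q' * w) (q * u' + r * v' - q' * u - r' * v)
    (2 * (x * q' - x' * q)) (x * r' + y * p' - x' * r - y' * p)
    (2 * (y * q' - y' * q))
    (2 * (v * y' - v' * y)) (u * x' + w * y' - u' * x - w' * y)
    (2 * (v * x' - v' * x)) :> 'M[F]_4.
Proof. by rewrite /sp4mx; mx4_ring. Qed.

(** The bracket with T_{a,b} has no Cartan part, so a nonzero weight forces the Cartan coordinates
    of an eigenvector to vanish. *)
Lemma commuting_eigenvectors_coord a b Y Z : commuting_eigenvectors a b Y Z ->
  (exists x y p q r u v w, Y = rootmx x y p q r u v w) /\
  (exists x y p q r u v w, Z = rootmx x y p q r u v w).
Proof.
have coord X l : in_sp4 X -> l != 0 -> lie_bracket (Tdiag a b) X = l *: X ->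
    exists x y p q r u v w, X = rootmx x y p q r u v w.
  move=> /in_sp4P[c [k [x [y [p [q [r [u [v [w ->]]]]]]]]]] l0.
  rewrite Tdiag_bracket scale_sp4mx => /sp4mx_inj[].
  move=> /esym/eqP c0 /esym/eqP k0 _ _ _ _ _ _ _ _.
  move: c0 k0; rewrite !mulf_eq0 (negPf l0) /= => /eqP-> /eqP->.
  by exists x, y, p, q, r, u, v, w.
by move=> [[spY spZ] [l l0 lY] [m m0 mZ] _ _]; split; apply: coord lY || apply: coord mZ.
Qed.

(** In this form each nonzero coordinate can be cancelled, which identifies the weight with the
    value of the corresponding root. *)
Lemma commuting_eigenvectors_eqs a b x y p q r u v w x' y' p' q' r' u' v' w' :
  let Y := rootmx x y p q r u v w in
  let Z := rootmx x' y' p' q' r' u' v' w' in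
  commuting_eigenvectors a b Y Z ->
  [/\ exists l, [/\ (a - b) * x = l * x, (b - a) * y = l * y,
          2 * a * p = l * p, (a + b) * q = l * q & 2 * b * r = l * r] /\
        [/\ - (2 * a) * u = l * u, - (a + b) * v = l * v & - (2 * b) * w = l * w],
      exists l, [/\ (a - b) * x' = l * x', (b - a) * y' = l * y',
          2 * a * p' = l * p', (a + b) * q' = l * q' & 2 * b * r' = l * r'] /\
        [/\ - (2 * a) * u' = l * u', - (a + b) * v' = l * v'
          & - (2 * b) * w' = l * w'],
      lie_bracket Y Z = 0,
      forall k, Z <> k *: Y & Y <> 0].
Proof.
move=> Y Z [_ [l _ +] [m _ +] YZ free].
rewrite !Tdiag_bracket !scale_sp4mx => /sp4mx_inj[_ _ E1 E2 E3 E4 E5 E6 E7 E8].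
move=> /sp4mx_inj[_ _ E1' E2' E3' E4' E5' E6' E7' E8']; split=> //.
- by exists l.
- by exists m.
- move=> k Zk; have [] := free (- k) 1; first by rewrite Zk scale1r scaleNr addNr.
  by move=> _ /eqP; rewrite oner_eq0.
- move=> Y0; have [] := free 1 0; first by rewrite Y0 scaler0 scale0r addr0.
  by move=> /eqP; rewrite oner_eq0.
Qed.

(* Squares absorb the sign of the difference of the two weights. *)
Lemma weight_neq_eq0 l l' d n x :
  d != 0 -> l' * x = l * x -> (l - l') ^+ 2 = (d *+ n.+1) ^+ 2 -> x = 0.
Proof.
move=> d0 E sq; apply/eqP; apply: contraT => x0.
have ll' : l' = l by apply: (mulIf x0).
move: sq; rewrite ll' subrr expr0n /= => /esym/eqP.
by rewrite expf_eq0 /= mulrn_eq0 (negPf d0).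
Qed.

Lemma regular_pair_sub a b : regular_pair a b -> a - b != 0 /\ a + b != 0.
Proof. by move=> [_ _ ? ?]; rewrite subr_eq0 addr_eq0. Qed.

Lemma regular_pair_admissible a b : regular_pair a b -> admissible (a / b).
Proof.
move=> [a0 b0 ab aNb]; split=> /eqP; apply/negP.
- by rewrite mulf_neq0 ?invr_eq0.
- by apply: contra ab => /eqP E; rewrite -[a](divfK b0) E mul1r.
- by apply: contra aNb => /eqP E; rewrite -[a](divfK b0) E mulN1r.
Qed.

Lemma Tdiag_scale a b : b != 0 -> Tdiag a b = b *: Tdiag (a / b) 1.
Proof.
move=> b0; rewrite !TdiagE scale_sp4mx !mulr0.
by rewrite (mulr1 b) mulrC divfK.
Qed.

Lemma Sp4_conjugate_refl s : Sp4_conjugate s s.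
Proof.
have S1 : in_Sp4 (1%:M : 'M[F]_4) by apply: mulmx_J4_unit; rewrite trmx1 mulmx1 mul1mx.
exists 1%:M; split=> //; rewrite -[RHS]lim1g; apply: eq_in_limg => X _.
by rewrite id_lfunE conj_endE mul1mx invmx1 mulmx1.
Qed.

Lemma classified_long a b r p : regular_pair a b -> r != 0 -> p != 0 ->
  classified (span3 (Tdiag a b) (rootmx 0 0 0 0 r 0 0 0) (rootmx 0 0 p 0 0 0 0 0)).
Proof.
move=> reg r0 p0; constructor 2; exists (a / b); split.
  exact: regular_pair_admissible.
case: (reg) => _ b0 _ _; rewrite /fam_long (Tdiag_scale _ b0).
have -> : rootmx 0 0 0 0 r 0 0 0 = r *: Xalpha F.
  by rewrite XalphaE scale_sp4mx !mulr0 (mulr1 r).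
have -> : rootmx 0 0 p 0 0 0 0 0 = p *: Xalpha_2beta F.
  by rewrite Xalpha_2betaE scale_sp4mx !mulr0 (mulr1 p).
by rewrite span3_scale //; apply: Sp4_conjugate_refl.
Qed.

Lemma classified_short a b r q : regular_pair a b -> r != 0 -> q != 0 ->
  classified (span3 (Tdiag a b) (rootmx 0 0 0 0 r 0 0 0) (rootmx 0 0 0 q 0 0 0 0)).
Proof.
move=> reg r0 q0; constructor 1; exists (a / b); split.
  exact: regular_pair_admissible.
case: (reg) => _ b0 _ _; rewrite /fam_short (Tdiag_scale _ b0).
have -> : rootmx 0 0 0 0 r 0 0 0 = r *: Xalpha F.
  by rewrite XalphaE scale_sp4mx !mulr0 (mulr1 r).
have -> : rootmx 0 0 0 q 0 0 0 0 = q *: Xalpha_beta F.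
  by rewrite Xalpha_betaE scale_sp4mx !mulr0 (mulr1 q).
by rewrite span3_scale //; apply: Sp4_conjugate_refl.
Qed.

Lemma classified_principal b x r p : b != 0 -> x != 0 -> r != 0 -> p != 0 ->
  classified (span3 (Tdiag (3 * b) b)
    (rootmx x 0 0 0 r 0 0 0) (rootmx 0 0 p 0 0 0 0 0)).
Proof.
move=> b0 x0 r0 p0; constructor 3.
(* Conjugation by diag(d, 1, 1/d, 1) multiplies x by d and p by d^2 and fixes r; this d makes the
   coefficients of X_alpha and X_beta equal. *)
pose d := r / x; have d0 : d != 0 by rewrite mulf_neq0 ?invr_eq0.
pose g : 'M[F]_4 := mx4 [:: d; 0; 0; 0;  0; 1; 0; 0;  0; 0; d^-1; 0;  0; 0; 0; 1].
have Sg : in_Sp4 g.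
  apply: mulmx_J4_unit; rewrite J4E /g; mx4_simpl; apply: congr1.
  by do ! (apply: eq_cons; first by field).
have := Sp4_conjugate_span3 (Tdiag (3 * b) b)
    (rootmx x 0 0 0 r 0 0 0) (rootmx 0 0 p 0 0 0 0 0) Sg.
rewrite (@conj_end_intertwine _ g _ (b *: Tdiag 3 1)) //; last first.
  by rewrite !TdiagE /g /sp4mx; mx4_ring.
rewrite (@conj_end_intertwine _ g _ (r *: (Xalpha F + Xbeta F))) //; last first.
  rewrite !root_vectorsE /g /sp4mx /d; mx4_simpl; apply: congr1.
  by do ! (apply: eq_cons; first by field; rewrite ?x0 ?r0).
rewrite (@conj_end_intertwine _ g _ ((p * d ^+ 2) *: Xalpha_2beta F)) //; last first.
  rewrite !root_vectorsE /g /sp4mx /d; mx4_simpl; apply: congr1.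
  by do ! (apply: eq_cons; first by field; rewrite ?x0 ?r0).
by rewrite span3_scale ?mulf_neq0 ?expf_neq0 ?invr_eq0.
Qed.

End Classification.

(** * Case analysis on the supports of Y and Z *)

Section CoreClassification.
Variable F : numFieldType.
Implicit Types (X Y Z g h : 'M[F]_4) (s t : {vspace 'M[F]_4}) (a b c k l m : F).
Implicit Types x y p q r u v w : F.

Notation rootmx := (sp4mx 0 0).

Lemma regular_pairN1 a b : regular_pair a b -> regular_pair (- a) b.
Proof. by move=> [a0 b0 ab aNb]; split; rewrite ?oppr_eq0 ?eqr_opp // eqr_oppLR. Qed.

Lemma regular_pairN2 a b : regular_pair a b -> regular_pair a (- b).
Proof. by move=> [a0 b0 ab aNb]; split; rewrite ?oppr_eq0 ?opprK. Qed.

Lemma regular_pairC a b : regular_pair a b -> regular_pair b a.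
Proof. by move=> [a0 b0 ab aNb]; split; rewrite // eq_sym // eqr_oppLR. Qed.

(* A pair of long root vectors, a long and a short one spanning an angle of 45
   degrees, or (when b = 3a) the principal algebra after exchanging a and b. *)
Lemma classified_alpha a b r y p : regular_pair a b -> r != 0 ->
  commuting_eigenvectors a b (rootmx 0 0 0 0 r 0 0 0) (rootmx 0 y p 0 0 0 0 0) ->
  classified (span3 (Tdiag a b) (rootmx 0 0 0 0 r 0 0 0) (rootmx 0 y p 0 0 0 0 0)).
Proof.
move=> reg r0 YZ; have [_ [l [[_ lY lP _ _] _]] _ Z0 _] := commuting_eigenvectors_eqs YZ.
have [p0|p0] := eqVneq p 0; have [y0|y0] := eqVneq y 0.
- by case: (Z0 0); rewrite p0 y0 scale0r sp4mx0.
- rewrite p0 in YZ *; apply: (weyl_flip1_pair YZ) => _; rewrite !oppr0.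
  by apply: classified_short; rewrite ?oppr_eq0 //; apply: regular_pairN1.
- by rewrite y0; apply: classified_long.
have b3a : b = 3 * a.
  move: lY; rewrite -(mulIf p0 lP) => /(mulIf y0) ba.
  by rewrite -[b](subrK a) ba; ring.
subst b; apply: (weyl_swap_pair YZ) => _; rewrite span3C.
by apply: classified_principal => //; case: reg.
Qed.

(** As r is nonzero, Y has weight 2b. Among the other roots only beta and -(alpha + beta) can take
    this value, for a = 3b and a = -3b. The second case is excluded, so Y = r X_alpha + x X_beta. *)
Lemma classified_alpha_coord a b x y p q r u v w x' y' p' q' r' u' v' w' :
  let Y := rootmx x y p q r u v w in
  let Z := rootmx x' y' p' q' r' u' v' w' in
  regular_pair a b -> r != 0 -> a != - (3 * b) -> commuting_eigenvectors a b Y Z ->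
  classified (span3 (Tdiag a b) Y Z).
Proof.
move=> Y Z reg r0 aN3b YZ.
have [a0 b0 _ _] := reg; have [ab aNb] := regular_pair_sub reg.
have [[l [[lx ly lp lq lr] [lu lv lw]]]] := commuting_eigenvectors_eqs YZ.
move=> [m [[mx my mp mq mr] [mu mv mw]]] + Zk _.
have l2b : l = 2 * b by apply: (mulIf r0); rewrite lr.
subst l.
have y0 : y = 0 by apply: (weight_neq_eq0 (d := a + b) (n := 0) _ ly) => //; ring.
have p0 : p = 0 by apply: (weight_neq_eq0 (d := a - b) (n := 1) _ lp) => //; ring.
have q0 : q = 0 by apply: (weight_neq_eq0 (d := a - b) (n := 0) _ lq) => //; ring.
have u0 : u = 0 by apply: (weight_neq_eq0 (d := a + b) (n := 1) _ lu) => //; ring.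
have w0 : w = 0 by apply: (weight_neq_eq0 (d := b) (n := 3) _ lw) => //; ring.
have v0 : v = 0.
  apply: (weight_neq_eq0 (d := a + 3 * b) (n := 0) _ lv); last by ring.
  by rewrite addr_eq0.
rewrite /Y /Z {}y0 {}p0 {}q0 {}u0 {}w0 {}v0 in YZ Zk *.
rewrite root_bracket -sp4mx0 => /sp4mx_inj.
rewrite !(mul0r, mulr0, add0r, addr0, subr0, sub0r).
case=> xy' + rv' + + _ + _.
have v'0 : v' = 0 by apply: (mulfI r0); rewrite rv' mulr0.
rewrite [y' * x]mulrC xy' oppr0 add0r => rw'.
have w'0 : w' = 0 by apply: (mulfI r0); rewrite rw' mulr0.
rewrite {}v'0 {}w'0 in YZ Zk * => xq' /eqP; rewrite subr_eq0 => /eqP xr' xu'.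
have [x0|x0] := eqVneq x 0.
  rewrite {}x0 in YZ Zk xr' *; rewrite mul0r in xr'.
  have x'0 : x' = 0 by apply: (mulIf r0); rewrite -xr' mul0r.
  rewrite {}x'0 in YZ Zk *.
  (* Otherwise Z has weight 2b as well, its other coordinates vanish, and it is a multiple of Y. *)
  have r'0 : r' = 0.
    apply/eqP; apply: contraT => r'0.
    have m2b : m = 2 * b by apply: (mulIf r'0); rewrite mr.
    subst m; case: (Zk (r' / r)).
    rewrite scale_sp4mx !mulr0 divfK //; congr sp4mx.
    - by apply: (weight_neq_eq0 (d := a + b) (n := 0) _ my) => //; ring.
    - by apply: (weight_neq_eq0 (d := a - b) (n := 1) _ mp) => //; ring.
    - by apply: (weight_neq_eq0 (d := a - b) (n := 0) _ mq) => //; ring.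
    - by apply: (weight_neq_eq0 (d := a + b) (n := 1) _ mu) => //; ring.
  rewrite {}r'0 in YZ Zk *.
  (* By weights Z is supported either on -beta and alpha + 2 beta, or on alpha + beta and -(alpha +
     2 beta). [weyl_flip1] exchanges these two pairs and fixes alpha. *)
  have [/andP[/eqP q'0 /eqP u'0]|qu] := boolP ((q' == 0) && (u' == 0)).
    by rewrite {}q'0 {}u'0 in YZ *; apply: classified_alpha.
  have [y'0 p'0] : y' = 0 /\ p' = 0.
    move: qu; rewrite negb_and => /orP[q'0|u'0].
      have mab : m = a + b by apply: (mulIf q'0); rewrite mq.
      subst m; split.
        by apply: (weight_neq_eq0 (d := a) (n := 1) _ my) => //; ring.
      by apply: (weight_neq_eq0 (d := a - b) (n := 0) _ mp) => //; ring.
    have m2a : m = - (2 * a) by apply: (mulIf u'0); rewrite mu.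
    subst m; split.
      by apply: (weight_neq_eq0 (d := a + b) (n := 0) _ my) => //; ring.
    by apply: (weight_neq_eq0 (d := a) (n := 3) _ mp) => //; ring.
  rewrite {}y'0 {}p'0 in YZ *; apply: (weyl_flip1_pair YZ); rewrite !oppr0.
  by apply: classified_alpha => //; apply: regular_pairN1.
have xI z : x * z = 0 -> z = 0 by move=> xz; apply: (mulfI x0); rewrite xz mulr0.
have y'0 : y' = 0 by apply: xI.
have q'0 : q' = 0.
  by apply: xI; apply/eqP; move/eqP: xq'; rewrite mulf_eq0 pnatr_eq0.
have u'0 : u' = 0.
  by apply: xI; apply/eqP; rewrite mulrC -oppr_eq0; apply/eqP.
rewrite {}y'0 {}q'0 {}u'0 in YZ Zk *.
(* X_alpha and X_beta occur together in Y, so their weights 2b and a - b agree. *)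
have a3b : a = 3 * b.
  by move/(mulIf x0): lx => ab2; rewrite -[a](subrK b) ab2; ring.
(* Without an alpha + 2 beta component, the commutation relation x r' = x' r makes Z proportional to
   Y. *)
subst a; have [p'0|p'0] := eqVneq p' 0.
  case: (Zk (r' / r)); rewrite p'0 scale_sp4mx !mulr0 divfK //.
  by congr sp4mx; apply: (mulIf r0); rewrite -xr' mulrAC divfK // mulrC.
have m6b : m = 2 * (3 * b) by apply: (mulIf p'0); rewrite mp.
subst m.
have x'0 : x' = 0 by apply: (weight_neq_eq0 (d := b) (n := 3) _ mx) => //; ring.
have r'0 : r' = 0 by apply: (weight_neq_eq0 (d := b) (n := 3) _ mr) => //; ring.
by rewrite {}x'0 {}r'0; apply: classified_principal.
Qed.

(** [weyl_flip1] keeps the alpha coordinate and turns the remaining case a = -3b into a = 3b. *)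
Lemma classified_long_coord a b x y p q r u v w Z :
  let Y := rootmx x y p q r u v w in
  regular_pair a b -> r != 0 -> commuting_eigenvectors a b Y Z ->
  classified (span3 (Tdiag a b) Y Z).
Proof.
move=> Y reg r0 YZ.
have [_ [x' [y' [p' [q' [r' [u' [v' [w' EZ]]]]]]]]] := commuting_eigenvectors_coord YZ.
rewrite {}EZ in YZ *.
have [aN3b|] := eqVneq a (- (3 * b)); last by move=> ?; apply: classified_alpha_coord.
apply: (weyl_flip1_pair YZ); apply: classified_alpha_coord => //.
  exact: regular_pairN1.
rewrite aN3b opprK -addr_eq0 -mulr2n mulrn_eq0 mulf_eq0 pnatr_eq0 /=.
by case: reg.
Qed.

Lemma classified_long_coords a b x y p q r u v w Z :
  let Y := rootmx x y p q r u v w in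
  regular_pair a b -> [|| p != 0, r != 0, u != 0 | w != 0] ->
  commuting_eigenvectors a b Y Z -> classified (span3 (Tdiag a b) Y Z).
Proof.
move=> Y reg nz YZ.
have [_ [x' [y' [p' [q' [r' [u' [v' [w' EZ]]]]]]]]] := commuting_eigenvectors_coord YZ.
rewrite {}EZ in YZ *.
case/or4P: nz => nz.
- apply: (weyl_swap_pair YZ); apply: classified_long_coord => //.
  exact: regular_pairC.
- exact: classified_long_coord.
- apply: (weyl_swap_pair YZ) => {}YZ.
  apply: (weyl_flip2_pair YZ); apply: classified_long_coord; rewrite ?oppr_eq0 //.
  by apply: regular_pairN2; apply: regular_pairC.
- apply: (weyl_flip2_pair YZ); apply: classified_long_coord; rewrite ?oppr_eq0 //.
  exact: regular_pairN2.
Qed.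

(* The hypotheses are contradictory: two non-proportional short root vectors
   never commute. *)
Lemma classified_short_q a b x y q v x' y' q' v' :
  let Y := rootmx x y 0 q 0 0 v 0 in
  let Z := rootmx x' y' 0 q' 0 0 v' 0 in
  regular_pair a b -> q != 0 -> commuting_eigenvectors a b Y Z ->
  classified (span3 (Tdiag a b) Y Z).
Proof.
move=> Y Z reg q0 YZ.
have [a0 b0 _ _] := reg; have [ab aNb] := regular_pair_sub reg.
have [[l [[lx ly _ lq _] [_ lv _]]]] := commuting_eigenvectors_eqs YZ.
move=> _ + Zk _.
have lab : l = a + b by apply: (mulIf q0); rewrite lq.
subst l.
have x0 : x = 0 by apply: (weight_neq_eq0 (d := b) (n := 1) _ lx) => //; ring.
have y0 : y = 0 by apply: (weight_neq_eq0 (d := a) (n := 1) _ ly) => //; ring.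
have v0 : v = 0 by apply: (weight_neq_eq0 (d := a + b) (n := 1) _ lv) => //; ring.
rewrite {}x0 {}y0 {}v0 in YZ Zk *.
rewrite root_bracket -sp4mx0 => /sp4mx_inj.
rewrite !(mul0r, mulr0, add0r, addr0, subr0, sub0r, oppr0).
have qI z : z * q = 0 -> z = 0 by move=> zq; apply: (mulIf q0); rewrite zq mul0r.
have q2I z : 2 * - (z * q) = 0 -> z = 0.
  by move/eqP; rewrite mulf_eq0 pnatr_eq0 oppr_eq0 => /eqP/qI.
case=> + _ /q2I x'0 /q2I y'0; rewrite mulrC => /qI v'0.
case: (Zk (q' / q)).
by rewrite x'0 y'0 v'0 scale_sp4mx !mulr0 divfK.
Qed.

(** Every short coordinate is carried to q: [weyl_flip2] moves x to q up to sign, [weyl_swap] moves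
    y to x, and [weyl_flip2] moves v to y. *)
Lemma classified_short_coords a b x y q v x' y' q' v' :
  let Y := rootmx x y 0 q 0 0 v 0 in
  let Z := rootmx x' y' 0 q' 0 0 v' 0 in
  regular_pair a b -> commuting_eigenvectors a b Y Z ->
  classified (span3 (Tdiag a b) Y Z).
Proof.
move=> Y Z reg YZ.
have viaX c k x1 y1 q1 v1 x2 y2 q2 v2 : regular_pair c k -> x1 != 0 ->
    commuting_eigenvectors c k (rootmx x1 y1 0 q1 0 0 v1 0)
      (rootmx x2 y2 0 q2 0 0 v2 0) ->
    classified (span3 (Tdiag c k) (rootmx x1 y1 0 q1 0 0 v1 0)
      (rootmx x2 y2 0 q2 0 0 v2 0)).
  move=> reg' x0 cYZ; apply: (weyl_flip2_pair cYZ); rewrite !oppr0.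
  by apply: classified_short_q; rewrite ?oppr_eq0 //; apply: regular_pairN2.
have viaY c k x1 y1 q1 v1 x2 y2 q2 v2 : regular_pair c k -> y1 != 0 ->
    commuting_eigenvectors c k (rootmx x1 y1 0 q1 0 0 v1 0)
      (rootmx x2 y2 0 q2 0 0 v2 0) ->
    classified (span3 (Tdiag c k) (rootmx x1 y1 0 q1 0 0 v1 0)
      (rootmx x2 y2 0 q2 0 0 v2 0)).
  move=> reg' y0 cYZ; apply: (weyl_swap_pair cYZ).
  by apply: viaX => //; apply: regular_pairC.
have [q0|q0] := eqVneq q 0; last exact: classified_short_q.
have [x0|x0] := eqVneq x 0; last exact: viaX.
have [y0|y0] := eqVneq y 0; last exact: viaY.
have [v0|v0] := eqVneq v 0.
  have [_ _ _ _] := commuting_eigenvectors_eqs YZ.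
  by rewrite q0 x0 y0 v0 sp4mx0.
apply: (weyl_flip2_pair YZ); rewrite !oppr0.
by apply: viaY => //; apply: regular_pairN2.
Qed.

Lemma classified_commuting_eigenvectors a b Y Z :
  regular_pair a b -> commuting_eigenvectors a b Y Z ->
  classified (span3 (Tdiag a b) Y Z).
Proof.
move=> reg YZ.
have [[x [y [p [q [r [u [v [w EY]]]]]]]]] := commuting_eigenvectors_coord YZ.
move=> [x' [y' [p' [q' [r' [u' [v' [w' EZ]]]]]]]]; rewrite {}EY {}EZ in YZ *.
have [longY|] := boolP [|| p != 0, r != 0, u != 0 | w != 0].
  exact: classified_long_coords.
have [longZ _|] := boolP [|| p' != 0, r' != 0, u' != 0 | w' != 0].
  rewrite span3C; apply: classified_long_coords => //.
  exact: commuting_eigenvectorsC.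
rewrite !negb_or !negbK => /and4P[/eqP p'0 /eqP r'0 /eqP u'0 /eqP w'0].
move=> /and4P[/eqP p0 /eqP r0 /eqP u0 /eqP w0].
rewrite {}p'0 {}r'0 {}u'0 {}w'0 {}p0 {}r0 {}u0 {}w0 in YZ *.
exact: classified_short_coords.
Qed.

End CoreClassification.

(** * Symplectic diagonalization of a regular semisimple element *)

Section Diagonalization.
Variable F : numFieldType.
Implicit Types (X Y Z g h : 'M[F]_4) (s t : {vspace 'M[F]_4}) (a b c k l m : F).

(** The rows of P are eigenvectors for the action on row vectors. Four distinct eigenvalues all
    occur among the four entries of d, so these entries are distinct. *)
Lemma regular_semisimple_diag X : regular_semisimple X ->
  exists P (d : 'rV[F]_4),
    [/\ P \in unitmx, P *m X = diag_mx d *m P & injective (d 0)].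
Proof.
move=> [[P Pu /similar_diagPex[d /(similarP Pu) PX]] [ev [sz_ev uniq_ev eig_ev]]].
exists P, d; split=> //.
have sub_ev : {subset ev <= [seq d 0 i | i : 'I_4]}.
  move=> e /(allP eig_ev) /eigenvalueP[v vX v0].
  have [w wD] : exists2 w : 'rV_4, w *m diag_mx d = e *: w & w != 0.
    exists (v *m invmx P).
      by rewrite -(mulmxK Pu (diag_mx d)) -PX !mulmxA mulmxKV // vX -scalemxAl.
    by apply: contra v0 => /eqP w0; rewrite -[v](mulmxKV Pu) w0 mul0mx.
  case/rV0Pn=> i wi; apply/mapP; exists i; first by rewrite mem_enum.
  by move/rowP: wD => /(_ i); rewrite mul_mx_diag !mxE mulrC => /(mulIf wi).
apply/injectiveP; apply: leq_size_uniq uniq_ev sub_ev _.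
by rewrite size_map -cardE card_ord sz_ev.
Qed.

Lemma in_sp4_J4 X : in_sp4 X -> X *m J4 F = - (J4 F *m X^T).
Proof.
by move/(congr1 (mulmx^~ (J4 F))) => <-; rewrite -mulmxA J4_sqr mulmxN mulmx1.
Qed.

Lemma sp4_regular_conj X : in_sp4 X -> regular_semisimple X ->
  exists g a b, [/\ in_Sp4 g, regular_pair a b & conj_end g X = Tdiag a b].
Proof.
move=> spX /regular_semisimple_diag[P [d [Pu PX inj_d]]].
(* W is the Gram matrix of the form J on the rows of P; the existential keeps it opaque except
   through [WE]. *)
have [W WE] : exists W, W = P *m J4 F *m P^T by exists (P *m J4 F *m P^T).
have WN i j : W i j = - W j i.
  have -> : W j i = W^T i j by rewrite mxE.
  have -> : W^T = - W; last by rewrite mxE opprK.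
  rewrite WE !trmx_mul trmxK mulmxA -mulNmx -mulmxN; congr (_ *m _ *m _).
  by rewrite J4E; mx4_ring.
(* Comparing entries in D W = -W D gives (d_i + d_j) W_ij = 0. *)
have Wd i j : d 0 i + d 0 j != 0 -> W i j = 0.
  move=> dij; have DW : diag_mx d *m W = - (W *m diag_mx d).
    rewrite {1}WE !mulmxA -PX -(mulmxA P) in_sp4_J4 // mulmxN mulNmx.
    congr (- _); rewrite mulmxA -(mulmxA (P *m J4 F)) -trmx_mul PX trmx_mul tr_diag_mx.
    by rewrite WE !mulmxA.
  move/matrixP: DW => /(_ i j); rewrite mul_diag_mx mul_mx_diag !mxE => /eqP.
  rewrite -addr_eq0 [W i j * _]mulrC -mulrDl mulf_eq0 (negPf dij) /=.
  by move/eqP.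
have Wu : W \in unitmx.
  rewrite WE !unitmx_mul unitmx_tr Pu /= andbT.
  by have /mulmx1_unit[] : J4 F *m - J4 F = 1%:M by rewrite mulmxN J4_sqr opprK.
(* No row of the invertible W vanishes, so each eigenvalue has its opposite among the
   eigenvalues. *)
have W_partner i : exists2 j, W i j != 0 & d 0 j = - d 0 i.
  have : row i W != 0.
    apply/eqP => Wi0; have := row_mul i W (invmx W).
    rewrite Wi0 mul0mx mulmxV // => /rowP/(_ i) /eqP.
    by rewrite !mxE eqxx oner_eq0.
  case/rV0Pn=> j; rewrite mxE => Wij; exists j => //.
  by apply/eqP; rewrite -addr_eq0 addrC; apply: contraT => /Wd W0;
    rewrite W0 eqxx in Wij.
have [j W0j dj] := W_partner ord0.
have Wii i : W i i = 0.
  by apply/eqP; move/eqP: (WN i i); rewrite -addr_eq0 -mulr2n mulrn_eq0.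
have j0 : j != ord0 by apply: contra W0j => /eqP->; rewrite Wii.
(* Any index outside the first pair starts the second one; l will be its partner. *)
have [k k0 kj] : exists2 k : 'I_4, k != ord0 & k != j.
  have [->|j1] := eqVneq j (inord 1).
    by exists (inord 2); rewrite -val_eqE /= !inordK.
  by exists (inord 1); rewrite 1?eq_sym // -val_eqE /= !inordK.
have [l Wkl dl] := W_partner k.
have lk : l != k by apply: contra Wkl => /eqP->; rewrite Wii.
pose a := d 0 ord0; pose b := d 0 k.
have reg : regular_pair a b.
  split.
  - by apply: contra j0 => /eqP a0; apply/eqP/inj_d; rewrite dj -/a a0 oppr0.
  - by apply: contra lk => /eqP b0; apply/eqP/inj_d; rewrite dl -/b b0 oppr0.
  - by apply: contra k0 => /eqP ab; apply/eqP/inj_d.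
  - by apply: contra kj => /eqP ab; apply/eqP/inj_d; rewrite dj -/a ab opprK.
have [ab_neq0 aNb_neq0] := regular_pair_sub reg.
have W0k : W ord0 k = 0 by apply: Wd.
have W0l : W ord0 l = 0 by apply: Wd; rewrite dl.
have Wjk : W j k = 0 by apply: Wd; rewrite dj addrC -oppr_eq0 opprB.
have Wjl : W j l = 0 by apply: Wd; rewrite dj dl -opprD oppr_eq0.
(* The order 0, k, j, l matches the block shape of J, and rescaling the last two eigenvectors makes
   both pairings equal to 1. *)
pose c := \row_(i < 4) [:: 1; 1; (W ord0 j)^-1; (W k l)^-1]`_i.
pose f (i : 'I_4) := nth ord0 [:: ord0; k; j; l] i.
pose g := diag_mx c *m rowsub f P.
have gX : g *m X = Tdiag a b *m g.
  rewrite -mulmxA mul_rowsub_mx PX; apply/matrixP => i m.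
  rewrite /Tdiag /g !mul_diag_mx !mxE mulrCA; congr (_ * _).
  by rewrite /f; case: i => [] [|[|[|[|?]]]] //= ?; rewrite ?dj ?dl.
have gJg : g *m J4 F *m g^T = diag_mx c *m mxsub f f W *m diag_mx c.
  rewrite trmx_mul tr_diag_mx trmx_mxsub !mulmxA; congr (_ *m _).
  by rewrite WE mxsub_mul -mul_rowsub_mx !mulmxA.
have Sg : in_Sp4 g.
  apply: mulmx_J4_unit; rewrite gJg J4E; apply/matrixP => i m.
  rewrite mul_mx_diag mxE mul_diag_mx !mxE /f.
  case: i m => [] [|[|[|[|?]]]] //= ? [] [|[|[|[|?]]]] //= ?;
  rewrite ?Wii ?W0k ?W0l ?Wjk ?Wjl ?(WN k ord0) ?(WN l ord0) ?(WN k j) ?(WN l j)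
    ?W0k ?W0l ?Wjk ?Wjl ?oppr0 ?mulr0 ?mul0r // ?mul1r ?mulr1 ?mulfV //.
  - by rewrite (WN j) mulrN mulVf.
  - by rewrite (WN l) mulrN mulVf.
exists g, a, b; split=> //; apply: conj_end_intertwine Sg gX.
Qed.

End Diagonalization.

(** * Weight components under ad T_{a,b} *)

Section WeightDecomposition.
Variable F : numFieldType.
Implicit Types (X Y Z g h : 'M[F]_4) (s t U V W : {vspace 'M[F]_4}).
Implicit Types (a b c k l m : F).

(** Eigenvalue of ad T_{a,b} on the matrix unit at (i, j). Working with all 4 by 4 matrices lets
    weight components be selected entry by entry. *)
Definition weight a b (i j : 'I_4) : F :=
  [:: a; b; - a; - b]`_i - [:: a; b; - a; - b]`_j.

Lemma Tdiag_bracketE a b X i j :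
  lie_bracket (Tdiag a b) X i j = weight a b i j * X i j.
Proof.
rewrite /lie_bracket /Tdiag mul_diag_mx mul_mx_diag !mxE [X i j * _]mulrC.
by rewrite -mulrBl.
Qed.

Definition weight_part a b l X : 'M[F]_4 :=
  \matrix_(i, j) (X i j *+ (weight a b i j == l)).

Lemma Tdiag_weight_part a b l X :
  lie_bracket (Tdiag a b) (weight_part a b l X) = l *: weight_part a b l X.
Proof.
apply/matrixP => i j; rewrite Tdiag_bracketE !mxE.
by case: eqP => [->|_]; rewrite ?mulr0n ?mulr0.
Qed.

(** Different positions may share a weight; [undup] makes each component occur once in the sum. *)
Definition weights a b : seq F :=
  undup [seq weight a b ij.1 ij.2 | ij : 'I_4 * 'I_4].

Lemma mem_weights a b i j : weight a b i j \in weights a b.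
Proof. by rewrite mem_undup; apply/mapP; exists (i, j); rewrite ?mem_enum. Qed.

Lemma sum_weight_part a b X : \sum_(l <- weights a b) weight_part a b l X = X.
Proof.
apply/matrixP => i j; rewrite summxE.
rewrite (bigD1_seq (weight a b i j)) ?mem_weights ?undup_uniq //=.
rewrite big1 ?mxE ?eqxx ?addr0 // => l; rewrite mxE eq_sym => /negPf->.
by rewrite mulr0n.
Qed.

Lemma weight_part_notin a b U X : X \notin U ->
  exists l, weight_part a b l X \notin U.
Proof.
move=> XU; have [/hasP[l _ lU]|/hasPn all_U] :=
  boolP (has (fun l => weight_part a b l X \notin U) (weights a b)).
  by exists l.
case/negP: XU; rewrite -(sum_weight_part a b X) big_seq.
by apply: memv_suml => l /all_U; rewrite negbK.
Qed.

(* Applying ad T - c for all the other weights [c] annihilates the other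
   components of X and rescales the one of weight l. *)
Lemma weight_part_mem a b l W X :
  (forall Y, Y \in W -> lie_bracket (Tdiag a b) Y \in W) ->
  X \in W -> weight_part a b l X \in W.
Proof.
move=> stW XW; pose r := [seq c <- weights a b | c != l].
have prodW (r0 : seq F) :
    (\matrix_(i, j) ((\prod_(c <- r0) (weight a b i j - c)) * X i j)) \in W.
  elim: r0 => [|c r0 IH].
    rewrite (_ : \matrix_(i, j) _ = X) //; apply/matrixP => i j.
    by rewrite mxE big_nil mul1r.
  have := memvB (stW _ IH) (memvZ c IH); congr (_ \in W); apply/matrixP => i j.
  by rewrite mxE Tdiag_bracketE !mxE big_cons; ring.
have d0 : \prod_(c <- r) (l - c) != 0.
  rewrite prodf_seq_neq0; apply/allP => c; rewrite mem_filter => /andP[cl _].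
  by rewrite /= subr_eq0 eq_sym.
have := memvZ (\prod_(c <- r) (l - c))^-1 (prodW r); congr (_ \in W).
apply/matrixP => i j; rewrite !mxE; case: eqP => [->|/eqP ijl].
  by rewrite mulKf.
suff -> : \prod_(c <- r) (weight a b i j - c) = 0 by rewrite mul0r mulr0.
apply/eqP; rewrite prodf_seq_eq0; apply/hasP; exists (weight a b i j).
  by rewrite mem_filter ijl mem_weights.
by rewrite /= subrr.
Qed.

Lemma lie_bracket_jacobi X Y Z : lie_bracket X (lie_bracket Y Z) =
  lie_bracket (lie_bracket X Y) Z + lie_bracket Y (lie_bracket X Z).
Proof.
rewrite /lie_bracket !mulmxBl !mulmxBr !mulmxA.
(* Once the six triple products are generalized, the identity is linear and holds entrywise. *)
move: (X *m Y *m Z) (X *m Z *m Y) (Y *m X *m Z) (Y *m Z *m X) (Z *m X *m Y) (Z *m Y *m X).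
by move=> A1 A2 A3 A4 A5 A6; apply/matrixP => i j; rewrite !mxE; ring.
Qed.

End WeightDecomposition.

(** * Structure of the subalgebra around its regular element *)

Section Structure.
Variable F : numFieldType.
Implicit Types (X Y Z g : 'M[F]_4) (s t h U V W : {vspace 'M[F]_4}).
Implicit Types (a b c k l m : F).

(** No root vanishes at a regular T_{a,b}, so its centralizer in the symplectic algebra consists of
    the diagonal T_{c,k}. *)
Lemma cartan_Tdiag_span a b X : in_sp4 X -> lie_bracket (Tdiag a b) X = 0 ->
  regular_pair a b -> X \notin <[Tdiag a b]>%VS ->
  cartan_subalgebra <<[:: X; Tdiag a b]>>%VS.
Proof.
move=> spX TX reg XT; have [a0 b0 _ _] := reg; have [ab aNb] := regular_pair_sub reg.
have [c [k EX]] : exists c k, X = Tdiag c k.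
  case/in_sp4P: spX TX => c [k [x [y [p [q [r [u [v [w ->]]]]]]]]].
  have zero (n z : F) : n != 0 -> n * z = 0 -> z = 0.
    by move=> n0 nz; apply: (mulfI n0); rewrite nz mulr0.
  have two_neq0 (n : F) : n != 0 -> 2 * n != 0 by move=> n0; rewrite mulf_neq0 ?pnatr_eq0.
  rewrite Tdiag_bracket -sp4mx0 => /sp4mx_inj[E1 E2 E3 E4 E5 E6 E7 E8].
  rewrite (zero _ _ _ E1) // (zero _ _ _ E2) -1?[b - a]opprB ?oppr_eq0 //.
  rewrite (zero _ _ _ E3) ?two_neq0 // (zero _ _ _ E4) // (zero _ _ _ E5) ?two_neq0 //.
  rewrite (zero _ _ _ E6) ?oppr_eq0 ?two_neq0 // (zero _ _ _ E7) ?oppr_eq0 //.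
  rewrite (zero _ _ _ E8) ?oppr_eq0 ?two_neq0 //.
  by exists c, k; rewrite TdiagE.
have memh Y : Y \in <<[:: X; Tdiag a b]>>%VS -> exists c k, Y = Tdiag c k.
  rewrite !span_cons span_nil addv0.
  move=> /memv_addP[_ /vlineP[z1 ->] [_ /vlineP[z2 ->] ->]].
  exists (z1 * c + z2 * a), (z1 * k + z2 * b).
  by rewrite EX !TdiagE !scale_sp4mx add_sp4mx !mulr0 !addr0.
have comm Y Z : Y \in <<[:: X; Tdiag a b]>>%VS -> Z \in <<[:: X; Tdiag a b]>>%VS ->
    lie_bracket Y Z = 0.
  move=> /memh[c1 [k1 ->]] /memh[c2 [k2 ->]].
  by rewrite [Tdiag c2 k2]TdiagE Tdiag_bracket !mulr0 sp4mx0.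
split=> //.
- split=> [Y /memh[c1 [k1 ->]]|Y Z hY hZ]; last by rewrite comm ?mem0v.
  by apply/in_sp4P; exists c1, k1, 0, 0, 0, 0, 0, 0, 0, 0; rewrite TdiagE.
- have T0 : Tdiag a b != 0.
    apply/eqP; rewrite TdiagE -sp4mx0 => /sp4mx_inj[a00 _].
    by rewrite a00 eqxx in a0.
  apply/eqP; rewrite -[2%N]/(size [:: X; Tdiag a b]) -/(free _).
  by rewrite free_cons span_seq1 XT seq1_free.
- by move=> Y /memh[c1 [k1 ->]]; apply: diagonalizable_diag.
Qed.

Lemma free3_zero X Y Z : X != 0 -> Y \notin <[X]>%VS ->
  Z \notin (<[X]> + <[Y]>)%VS ->
  forall c k l, c *: X + k *: Y + l *: Z = 0 -> [/\ c = 0, k = 0 & l = 0].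
Proof.
move=> X0 YX ZXY c k l E.
have l0 : l = 0.
  apply/eqP; apply: contraR ZXY => l0; rewrite -[Z](scalerK l0) memvZ //.
  move/eqP: E; rewrite addrC addr_eq0 => /eqP->.
  by rewrite memvN memv_add ?memvZ ?memv_line.
rewrite l0 scale0r addr0 in E.
have k0 : k = 0.
  apply/eqP; apply: contraR YX => k0; rewrite -[Y](scalerK k0) memvZ //.
  by move/eqP: E; rewrite addrC addr_eq0 => /eqP->; rewrite memvN memvZ ?memv_line.
rewrite k0 scale0r addr0 in E; split=> //.
by apply/eqP; move/eqP: E; rewrite scaler_eq0 (negPf X0) orbF.
Qed.

Lemma lie_bracketZl c X Y : lie_bracket (c *: X) Y = c *: lie_bracket X Y.
Proof. by rewrite /lie_bracket -scalemxAl -scalemxAr scalerBr. Qed.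

Lemma lie_bracketZr c X Y : lie_bracket X (c *: Y) = c *: lie_bracket X Y.
Proof. by rewrite /lie_bracket -scalemxAl -scalemxAr scalerBr. Qed.

Lemma lie_bracketDr X Y Z : lie_bracket X (Y + Z) = lie_bracket X Y + lie_bracket X Z.
Proof. by rewrite /lie_bracket mulmxDl mulmxDr opprD addrACA. Qed.

Lemma lie_bracketXX X : lie_bracket X X = 0.
Proof. exact: subrr. Qed.

Lemma mem_derived_algebra s X Y :
  X \in s -> Y \in s -> lie_bracket X Y \in derived_algebra s.
Proof. by move: X Y; apply/derived_algebra_subP. Qed.

Lemma ad_stable_span W a b :
  sp4_subalgebra W -> \dim W = 3%N -> regular_pair a b -> Tdiag a b \in W ->
  ~ (exists h, cartan_subalgebra h /\ (h <= W)%VS) ->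
  ~~ (W <= derived_algebra W)%VS ->
  exists Y Z, commuting_eigenvectors a b Y Z /\ W = span3 (Tdiag a b) Y Z.
Proof.
move=> [spW brW] dimW reg TW no_cartan not_perfect.
have [a0 b0 _ _] := reg.
set T := Tdiag a b in TW *.
have stW X : X \in W -> lie_bracket T X \in W by apply: brW.
have T0 : T != 0.
  by apply/eqP; rewrite /T TdiagE -sp4mx0 => /sp4mx_inj[/eqP]; rewrite (negPf a0).
(* Some weight component of X lies outside U, hence outside the line of T. If its weight were zero,
   it would span with T a Cartan subalgebra inside W. *)
have nonzero_weight U X : (<[T]> <= U)%VS -> X \in W -> X \notin U ->
    exists Y l, [/\ l != 0, Y \in W, Y \notin U & lie_bracket T Y = l *: Y].
  move=> TU XW /(weight_part_notin a b)[l lU].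
  have XlW := weight_part_mem l stW XW; have TXl := Tdiag_weight_part a b l X.
  exists (weight_part a b l X), l; split=> //; apply/eqP => l0.
  apply: no_cartan; exists <<[:: weight_part a b l X; T]>>%VS; split.
    apply: cartan_Tdiag_span => //; first exact: spW.
      by rewrite TXl l0 scale0r.
    by apply: contra lU; apply: subvP.
  by apply/span_subvP => Y; rewrite !inE => /orP[]/eqP->.
have dim_line X : (\dim <[X]> <= 1)%N by rewrite dim_vline leq_b1.
have /subvPn[X XW XT] : ~~ (W <= <[T]>)%VS.
  by apply: contraL (dim_line T) => /dimvS; rewrite dimW -ltnNge => /(leq_trans _)->.
have [Y [l [l0 YW YT lY]]] := nonzero_weight <[T]>%VS X (subvv _) XW XT.
have /subvPn[X' X'W X'U] : ~~ (W <= <[T]> + <[Y]>)%VS.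
  apply/negP => /dimvS; rewrite dimW leqNgt ltnS.
  rewrite (leq_trans (fst (dimv_add_leqif <[T]> <[Y]>)%VS)) //.
  exact: leq_add (dim_line T) (dim_line Y).
have [Z [m [m0 ZW ZU mZ]]] := nonzero_weight _ X' (addvSl _ <[Y]>) X'W X'U.
have free3 := free3_zero T0 YT ZU.
have defW : W = span3 T Y Z.
  apply/esym/eqP; rewrite eqEdim; apply/andP; split.
    by apply/span_subvP => A; rewrite !inE => /or3P[]/eqP->.
  have /eqP fr : free [:: Z; Y; T].
    by rewrite !free_cons nil_free !span_cons span_nil !addv0 [(<[Y]> + _)%VS]addvC
      ZU YT memv0 T0.
  have -> : span3 T Y Z = <<[:: Z; Y; T]>>%VS.
    by apply: eq_span => A; rewrite !inE; case: (A == T) (A == Y) (A == Z) => [] [] [].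
  by rewrite dimW fr.
exists Y, Z; split=> //; split.
- by split; apply: spW.
- by exists l.
- by exists m.
(* With [Y, Z] = c T + k Y + k' Z, applying ad T and comparing with the weight l + m gives (l + m) c
   = 0, m k = 0 and l k' = 0. *)
- have := brW _ _ YW ZW; rewrite {1}defW => /memv_span3[c [k [k' E]]].
  have := lie_bracket_jacobi T Y Z; rewrite lY mZ.
  rewrite lie_bracketZl lie_bracketZr -scalerDl {1}E.
  rewrite !lie_bracketDr !lie_bracketZr lie_bracketXX lY mZ scaler0 add0r => jac.
  have [|_ /eqP + /eqP] := free3 ((l + m) * c) (m * k) (l * k').
    have -> : (l + m) * c *: T + m * k *: Y + l * k' *: Z =
        (l + m) *: (c *: T + k *: Y + k' *: Z) - (k *: (l *: Y) + k' *: (m *: Z)).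
      by apply/matrixP => i j; rewrite !mxE; ring.
    by rewrite jac E subrr.
  rewrite !mulf_eq0 (negPf m0) (negPf l0) /= => /eqP k0 /eqP k'0.
  rewrite k0 k'0 !scale0r !addr0 in E; rewrite E.
  (* If c is nonzero, then T, Y and Z are multiples of [Y, Z], [T, Y] and [T, Z], which makes W
     perfect. *)
  have [->|c0] := eqVneq c 0; first by rewrite scale0r.
  case/negP: not_perfect; rewrite {1}defW; apply/span_subvP => A.
  rewrite !inE => /or3P[]/eqP->.
  - by rewrite -[T](scalerK c0) -E memvZ ?mem_derived_algebra.
  - by rewrite -[Y](scalerK l0) -lY memvZ ?mem_derived_algebra.
  - by rewrite -[Z](scalerK m0) -mZ memvZ ?mem_derived_algebra.
- by move=> c k E; have [] := free3 0 c k; rewrite ?scale0r ?add0r.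
Qed.

Lemma derived_algebra_mono s t :
  (s <= t)%VS -> (derived_algebra s <= derived_algebra t)%VS.
Proof.
move=> /subvP st; apply/derived_algebra_subP => X Y sX sY.
by apply: mem_derived_algebra; apply: st.
Qed.

(** By monotonicity a perfect s is contained in every term of its derived series, one of which is
    zero. *)
Lemma lie_solvable_not_perfect s :
  lie_solvable s -> s != 0%VS -> ~~ (s <= derived_algebra s)%VS.
Proof.
move=> [n sn0]; apply: contra => perf; rewrite -subv0 -sn0.
elim: n {sn0} => [|n IH] /=; first exact: subvv.
exact: subv_trans perf (derived_algebra_mono IH).
Qed.

Lemma conj_end_inj g : in_Sp4 g -> injective (conj_end g).
Proof.
move=> Sg X Y /(congr1 (conj_end (invmx g))).
rewrite -!conj_end_mul //; try exact: in_Sp4_inv.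
have gu : g \in unitmx by case: Sg.
by rewrite mulVmx // !conj_endE invmx1 !mul1mx !mulmx1.
Qed.

Lemma dim_conj g s : in_Sp4 g -> \dim (conj_end g @: s) = \dim s.
Proof.
move=> Sg; apply: limg_dim_eq; have /lker0P/eqP-> := conj_end_inj Sg.
exact: capv0.
Qed.

Lemma sp4_subalgebra_conj g s :
  in_Sp4 g -> sp4_subalgebra s -> sp4_subalgebra (conj_end g @: s)%VS.
Proof.
move=> Sg [sps brs]; split=> [_ /memv_imgP[X sX ->]|].
  by apply: in_sp4_conj => //; apply: sps.
move=> _ _ /memv_imgP[X sX ->] /memv_imgP[Y sY ->].
by rewrite -conj_end_bracket // memv_img // brs.
Qed.

Lemma cartan_subalgebra_conj g h :
  in_Sp4 g -> cartan_subalgebra h -> cartan_subalgebra (conj_end g @: h)%VS.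
Proof.
move=> Sg [sph dimh comm diag]; split.
- exact: sp4_subalgebra_conj.
- by rewrite dim_conj.
- move=> _ _ /memv_imgP[X hX ->] /memv_imgP[Y hY ->].
  by rewrite -conj_end_bracket // comm // linear0.
move=> _ /memv_imgP[X hX ->]; have [P Pu PX] := diag X hX.
have gu : g \in unitmx by case: Sg.
have Pgu : P *m invmx g \in unitmx by rewrite unitmx_mul Pu unitmx_inv.
exists (P *m invmx g) => //.
have [D /(similarP Pu) PD] := similar_diagPex PX.
apply/similar_diagPex; exists D; apply/(similarP Pgu).
by rewrite conj_endE !mulmxA mulmxKV // PD.
Qed.

Lemma derived_algebra_conj g s : in_Sp4 g ->
  (derived_algebra (conj_end g @: s) <= conj_end g @: derived_algebra s)%VS.
Proof.
move=> Sg; apply/derived_algebra_subP => _ _ /memv_imgP[X sX ->] /memv_imgP[Y sY ->].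
by rewrite -conj_end_bracket // memv_img // mem_derived_algebra.
Qed.

Lemma classification s :
  sp4_subalgebra s -> \dim s = 3%N -> lie_solvable s ->
  (exists X, X \in s /\ regular_semisimple X) ->
  ~ (exists h, cartan_subalgebra h /\ (h <= s)%VS) ->
  classified s.
Proof.
move=> sps dims solv [X [sX regX]] no_cartan.
have [g [a [b [Sg reg gX]]]] := sp4_regular_conj (proj1 sps X sX) regX.
pose W := (conj_end g @: s)%VS.
have sW : Sp4_conjugate s W by exists g.
apply: (classified_conj sW).
have [||||||Y [Z [YZ ->]]] := @ad_stable_span W a b.
- exact: sp4_subalgebra_conj.
- by rewrite dim_conj.
- exact: reg.
- by rewrite -gX memv_img.
- move=> [h [cartan_h hW']]; apply: no_cartan.
  exists (conj_end (invmx g) @: h)%VS; split.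
    by apply: cartan_subalgebra_conj => //; apply: in_Sp4_inv.
  by rewrite -(limg_conjK s Sg) limgS.
(* Perfectness of W would pull back along g to s, where solvability forbids it. *)
- have s0 : s != 0%VS by apply: contra_eq_neq dims => ->; rewrite dimv0.
  apply: contra (lie_solvable_not_perfect solv s0) => perfW.
  rewrite -[s in (s <= _)%VS](limg_conjK _ Sg) -[derived_algebra s](limg_conjK _ Sg).
  by rewrite limgS // (subv_trans perfW) // derived_algebra_conj.
exact: classified_commuting_eigenvectors.
Qed.

End Structure.

(** * Invariants that separate the listed algebras *)

Section Inequivalence.
Variable F : numFieldType.
Implicit Types (X Y Z g : 'M[F]_4) (s t : {vspace 'M[F]_4}) (a b c k l m : F).

(** Rank at most one, in a form that is visibly stable under conjugation and yields the vanishing of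
    2 by 2 minors. *)
Definition outer_product X : Prop :=
  exists (u : 'cV[F]_4) (v : 'rV[F]_4), X = u *m v.

Lemma outer_product_minor X (i j k l : 'I_4) :
  outer_product X -> X i j * X k l = X i l * X k j.
Proof. by move=> [u [v ->]]; rewrite !mxE !big_ord1; ring. Qed.

Lemma outer_product_conj g X : outer_product X -> outer_product (conj_end g X).
Proof.
by move=> [u [v ->]]; exists (g *m u), (v *m invmx g); rewrite conj_endE !mulmxA.
Qed.

Lemma outer_product_Xalpha : outer_product (Xalpha F).
Proof.
exists (\col_i (i == 1%N :> nat)%:R), (\row_j (j == 3%N :> nat)%:R).
apply/matrixP => i j; rewrite !mxE big_ord1 !mxE.
by case: i j => [] [|[|[|[|?]]]] //= ? [] [|[|[|[|?]]]] //= ?;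
  rewrite ?mulr0 ?mul0r ?mulr1.
Qed.

Lemma outer_product_Xalpha_2beta : outer_product (Xalpha_2beta F).
Proof.
exists (\col_i (i == 0%N :> nat)%:R), (\row_j (j == 2%N :> nat)%:R).
apply/matrixP => i j; rewrite !mxE big_ord1 !mxE.
by case: i j => [] [|[|[|[|?]]]] //= ? [] [|[|[|[|?]]]] //= ?;
  rewrite ?mulr0 ?mul0r ?mulr1.
Qed.

(** General element of the Borel subalgebra of the positive roots, which contains all the listed
    algebras. *)
Definition borelmx c k x p q r : 'M[F]_4 := sp4mx c k x 0 p q r 0 0 0.

(** Each relation is a 2 by 2 minor. The lower left block is zero, so the first two minors reduce to
    -c^2 = 0 and -k^2 = 0. *)
Lemma outer_product_borelmx c k x p q r : outer_product (borelmx c k x p q r) ->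
  [/\ c = 0, k = 0, p * r = q ^+ 2 & x * r = 0].
Proof.
move=> out; pose e (n : nat) (lt_n : (n < 4)%N) := Ordinal lt_n.
have c0 : c = 0.
  have := outer_product_minor (@e 0%N isT) (@e 0%N isT) (@e 2%N isT) (@e 2%N isT) out.
  rewrite !mxE /= mulr0 => /eqP.
  by rewrite mulrN oppr_eq0 mulf_eq0 orbb => /eqP.
have k0 : k = 0.
  have := outer_product_minor (@e 1%N isT) (@e 1%N isT) (@e 3%N isT) (@e 3%N isT) out.
  rewrite !mxE /= mulr0 => /eqP.
  by rewrite mulrN oppr_eq0 mulf_eq0 orbb => /eqP.
split=> //.
  have := outer_product_minor (@e 0%N isT) (@e 2%N isT) (@e 1%N isT) (@e 3%N isT) out.
  by rewrite !mxE.
have := outer_product_minor (@e 0%N isT) (@e 1%N isT) (@e 1%N isT) (@e 3%N isT) out.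
by rewrite !mxE /= k0 mulr0.
Qed.

Lemma borelmx_bracket c k x p q r c' k' x' p' q' r' :
  lie_bracket (borelmx c k x p q r) (borelmx c' k' x' p' q' r') =
  borelmx 0 0 ((c - k) * x' - (c' - k') * x)
    (2 * c * p' - 2 * c' * p + 2 * (x * q' - x' * q))
    ((c + k) * q' - (c' + k') * q + x * r' - x' * r)
    (2 * k * r' - 2 * k' * r).
Proof. by rewrite /borelmx /sp4mx; mx4_ring. Qed.

Lemma borelmx_inj c k x p q r c' k' x' p' q' r' :
  borelmx c k x p q r = borelmx c' k' x' p' q' r' ->
  [/\ c = c', k = k' & x = x'] /\ [/\ p = p', q = q' & r = r'].
Proof. by move/sp4mx_inj => -[-> -> -> -> -> ->]. Qed.

Lemma scale_borelmx l c k x p q r :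
  l *: borelmx c k x p q r = borelmx (l * c) (l * k) (l * x) (l * p) (l * q) (l * r).
Proof. by rewrite /borelmx scale_sp4mx !mulr0. Qed.

Lemma fam_short_mem b X : X \in fam_short b ->
  exists c q r, X = borelmx (c * b) c 0 0 q r.
Proof.
move/memv_span3 => [c [r [q ->]]]; exists c, q, r.
rewrite TdiagE !root_vectorsE !scale_sp4mx !add_sp4mx !mulr0 !addr0 !add0r.
by rewrite (mulr1 c) (mulr1 q) (mulr1 r).
Qed.

Lemma fam_long_mem b X : X \in fam_long b ->
  exists c p r, X = borelmx (c * b) c 0 p 0 r.
Proof.
move/memv_span3 => [c [r [p ->]]]; exists c, p, r.
rewrite TdiagE !root_vectorsE !scale_sp4mx !add_sp4mx !mulr0 !addr0 !add0r.
by rewrite (mulr1 c) (mulr1 p) (mulr1 r).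
Qed.

Lemma alg_principal_mem X : X \in alg_principal F ->
  exists c p r, X = borelmx (c * 3) c r p 0 r.
Proof.
move/memv_span3 => [c [r [p ->]]]; exists c, p, r.
rewrite TdiagE !root_vectorsE add_sp4mx !scale_sp4mx !add_sp4mx !(addr0, add0r, mulr0).
by rewrite (mulr1 c) (mulr1 p) (mulr1 r).
Qed.

Lemma borelmx0 : borelmx 0 0 0 0 0 0 = 0.
Proof. exact: sp4mx0. Qed.

Lemma conj_eigenvector g s t H E l : in_Sp4 g -> (conj_end g @: s)%VS = t ->
  E \in s -> lie_bracket H E = l *: E -> E != 0 ->
  [/\ conj_end g E \in t, conj_end g E != 0
    & lie_bracket (conj_end g H) (conj_end g E) = l *: conj_end g E].
Proof.
move=> Sg <- sE HE E0; split; first exact: memv_img.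
  by apply: contra E0 => /eqP gE0; apply/eqP/(conj_end_inj Sg); rewrite gE0 linear0.
by rewrite -conj_end_bracket // HE linearZ.
Qed.

Lemma mem_span3 X Y Z :
  [/\ X \in span3 X Y Z, Y \in span3 X Y Z & Z \in span3 X Y Z].
Proof. by split; apply: memv_span; rewrite !inE eqxx ?orbT. Qed.

Lemma Tdiag_Xalpha a b :
  lie_bracket (Tdiag a b) (Xalpha F) = (2 * b) *: Xalpha F.
Proof. by rewrite XalphaE Tdiag_bracket scale_sp4mx !mulr0. Qed.

Lemma Tdiag_Xalpha_2beta a b :
  lie_bracket (Tdiag a b) (Xalpha_2beta F) = (2 * a) *: Xalpha_2beta F.
Proof. by rewrite Xalpha_2betaE Tdiag_bracket scale_sp4mx !mulr0. Qed.

Lemma Tdiag_Xalpha_beta a b :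
  lie_bracket (Tdiag a b) (Xalpha_beta F) = (a + b) *: Xalpha_beta F.
Proof. by rewrite Xalpha_betaE Tdiag_bracket scale_sp4mx !mulr0. Qed.

Lemma root_vectors_neq0 :
  [/\ Xalpha F != 0, Xalpha_beta F != 0 & Xalpha_2beta F != 0].
Proof.
by split; apply/eqP; rewrite !root_vectorsE -sp4mx0 => /sp4mx_inj[] /eqP;
  rewrite oner_eq0.
Qed.

(** Here p = 0, so p r = q^2 leaves only multiples of X_alpha. The acting element is a general
    member of the family, since a conjugation may send T_{a,1} to any such member. *)
Lemma fam_short_outer_product b c q r l E :
  E \in fam_short b -> E != 0 -> outer_product E ->
  lie_bracket (borelmx (c * b) c 0 0 q r) E = l *: E -> l = 2 * c.
Proof.
move=> /fam_short_mem[c' [q' [r' ->]]] E0 /outer_product_borelmx[_ c'0 /esym + _].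
rewrite mul0r => /eqP; rewrite expf_eq0 /= => /eqP q'0.
rewrite borelmx_bracket scale_borelmx => /borelmx_inj[_ [_ _]].
rewrite c'0 !(mul0r, mulr0, subr0) => /esym/mulIf-> //.
by apply: contra E0 => /eqP r'0; rewrite c'0 q'0 r'0 mul0r borelmx0.
Qed.

Lemma fam_long_outer_product b c p r l E :
  E \in fam_long b -> E != 0 -> outer_product E ->
  lie_bracket (borelmx (c * b) c 0 p 0 r) E = l *: E ->
  l = 2 * c \/ l = 2 * (c * b).
Proof.
move=> /fam_long_mem[c' [p' [r' ->]]] E0 /outer_product_borelmx[_ c'0 _ _].
rewrite borelmx_bracket scale_borelmx c'0 => /borelmx_inj[_].
rewrite !(mul0r, mulr0, subr0, addr0) => -[p'E _ r'E].
have [r'0|r'0] := eqVneq r' 0; last by left; rewrite (mulIf r'0 r'E).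
have [p'0|p'0] := eqVneq p' 0; last by right; rewrite (mulIf p'0 p'E).
by case/eqP: E0; rewrite c'0 p'0 r'0 mul0r borelmx0.
Qed.

(** The coordinates x and r coincide, so x r = 0 kills both and only multiples of X_{alpha+2beta}
    have rank one. *)
Lemma alg_principal_outer_product c p r l E :
  E \in alg_principal F -> E != 0 -> outer_product E ->
  lie_bracket (borelmx (c * 3) c r p 0 r) E = l *: E -> l = 2 * (c * 3).
Proof.
move=> /alg_principal_mem[c' [p' [r' ->]]] E0 /outer_product_borelmx[_ c'0 _ /eqP].
rewrite mulf_eq0 orbb => /eqP r'0.
rewrite borelmx_bracket scale_borelmx => /borelmx_inj[_ [+ _ _]].
rewrite c'0 r'0 !(mul0r, mulr0, subr0, addr0) => /esym/mulIf-> //.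
by apply: contra E0 => /eqP p'0; rewrite c'0 r'0 p'0 mul0r borelmx0.
Qed.

(* In the long family the outer products X_alpha and X_(alpha + 2 beta) have the
   distinct weights 2 and 2a; elsewhere outer products have only one weight. *)
Lemma fam_long_conj g a t (P : F -> Prop) :
  in_Sp4 g -> (conj_end g @: fam_long a)%VS = t ->
  (forall E l, E \in t -> E != 0 -> outer_product E ->
     lie_bracket (conj_end g (Tdiag a 1)) E = l *: E -> P l) ->
  P 2 /\ P (2 * a).
Proof.
move=> Sg gst Pl; have [Xa0 _ Xl0] := root_vectors_neq0.
have [_ sXa sXl] := mem_span3 (Tdiag a 1) (Xalpha F) (Xalpha_2beta F).
have [gXa gXa0 gXa2] := conj_eigenvector Sg gst sXa (Tdiag_Xalpha a 1) Xa0.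
have [gXl gXl0 gXl2] := conj_eigenvector Sg gst sXl (Tdiag_Xalpha_2beta a 1) Xl0.
split.
  rewrite -[2]mulr1; apply: Pl gXa gXa0 _ gXa2.
  exact: outer_product_conj outer_product_Xalpha.
by apply: Pl gXl gXl0 _ gXl2; apply: outer_product_conj outer_product_Xalpha_2beta.
Qed.

Lemma two_inj k l : 2 * k = 2 * l -> k = l.
Proof. by apply: mulfI; rewrite pnatr_eq0. Qed.

Lemma two_inj1 k : 2 = 2 * k -> k = 1.
Proof. by rewrite -{1}[2]mulr1 => /two_inj. Qed.

Lemma fam_long_short_Nconj a b :
  admissible a -> ~ Sp4_conjugate (fam_long a) (fam_short b).
Proof.
move=> [_ a1 _] [g [Sg gst]].
have [sT _ _] := mem_span3 (Tdiag a 1) (Xalpha F) (Xalpha_2beta F).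
have := memv_img (conj_end g) sT; rewrite gst => /fam_short_mem[c [q [r gT]]].
have [|c2 c2a] := @fam_long_conj g a _ (fun l => l = 2 * c) Sg gst.
  by move=> E l tE E0 oE; rewrite gT; apply: fam_short_outer_product.
by apply/a1/two_inj1; rewrite c2a.
Qed.

Lemma fam_long_principal_Nconj a :
  admissible a -> ~ Sp4_conjugate (fam_long a) (alg_principal F).
Proof.
move=> [_ a1 _] [g [Sg gst]].
have [sT _ _] := mem_span3 (Tdiag a 1) (Xalpha F) (Xalpha_2beta F).
have := memv_img (conj_end g) sT; rewrite gst => /alg_principal_mem[c [p [r gT]]].
have [|c2 c2a] := @fam_long_conj g a _ (fun l => l = 2 * (c * 3)) Sg gst.
  by move=> E l tE E0 oE; rewrite gT; apply: alg_principal_outer_product.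
by apply/a1/two_inj1; rewrite c2a.
Qed.

(** Both 2 and 2a lie in {2c, 2cb}, and they differ because a is not 1. Matching them gives c = 1
    and a = b, or cb = 1 and a = c. *)
Lemma fam_long_conj_eq a b : admissible a -> admissible b ->
  Sp4_conjugate (fam_long a) (fam_long b) -> a = b \/ a = b^-1.
Proof.
move=> [_ a1 _] [/eqP b0 _ _] [g [Sg gst]].
have [sT _ _] := mem_span3 (Tdiag a 1) (Xalpha F) (Xalpha_2beta F).
have := memv_img (conj_end g) sT; rewrite gst => /fam_long_mem[c [p [r gT]]].
have [|] := @fam_long_conj g a _ (fun l => l = 2 * c \/ l = 2 * (c * b)) Sg gst.
  by move=> E l tE E0 oE; rewrite gT; apply: fam_long_outer_product.
move=> [/two_inj1 c1|/two_inj1 cb1] [/two_inj ac|/two_inj acb].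
- by case: a1; rewrite ac.
- by left; rewrite acb c1 mul1r.
- by right; rewrite ac; apply: (mulIf b0); rewrite cb1 mulVf.
- by case: a1; rewrite acb.
Qed.

(** The rank one vector X_alpha fixes c = 1, so the image of T_{a,1} acts with weights 2 and b + 1
    on the nilpotent part. The image of X_{alpha+beta} has weight a + 1, which must be b + 1. *)
Lemma fam_short_conj_eq a b : admissible a -> admissible b ->
  Sp4_conjugate (fam_short a) (fam_short b) -> a = b.
Proof.
move=> [_ /eqP a1 /eqP aN1] _ [g [Sg gst]]; have [Xa0 Xs0 _] := root_vectors_neq0.
have [sT sXa sXs] := mem_span3 (Tdiag a 1) (Xalpha F) (Xalpha_beta F).
have := memv_img (conj_end g) sT; rewrite gst => /fam_short_mem[c [q [r gT]]].
have [gXa gXa0] := conj_eigenvector Sg gst sXa (Tdiag_Xalpha a 1) Xa0.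
have gXa_outer := outer_product_conj g outer_product_Xalpha.
rewrite gT => /fam_short_outer_product-/(_ gXa gXa0 gXa_outer).
rewrite mulr1 => /two_inj1 c1.
have [gXs gXs0] := conj_eigenvector Sg gst sXs (Tdiag_Xalpha_beta a 1) Xs0.
rewrite gT c1; case/fam_short_mem: gXs gXs0 => c' [q' [r' ->]] gXs0.
rewrite borelmx_bracket scale_borelmx => /borelmx_inj[[_ /esym/eqP + _] [_ + +]].
(* As a is not -1, the weight a + 1 is nonzero and the image has no Cartan part; a being different
   from 1 then excludes the weight 2. *)
rewrite mulf_eq0 addr_eq0 (negPf aN1) /= => /eqP c'0.
rewrite c'0 !(mul0r, mulr0, mul1r, mulr1, add0r, addr0, subr0) => q'E r'E.
have r'0 : r' = 0.
  apply/eqP; apply: contraR a1 => /mulIf/(_ _ _ r'E) a2.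
  by apply/eqP/(addIr 1); rewrite -a2; ring.
apply/esym; apply: (addIr 1); apply: (mulIf _ q'E).
by apply: contra gXs0 => /eqP q'0; rewrite c'0 q'0 r'0 mul0r borelmx0.
Qed.

(** The swap sends T_{a,1} to T_{1,a}, a multiple of T_{1/a,1}, and exchanges the two long root
    vectors. *)
Lemma fam_long_inv a : a != 0 -> Sp4_conjugate (fam_long a) (fam_long a^-1).
Proof.
move=> a0; exists (weyl_swap F); split; first exact: weyl_swapP.
rewrite limg_span /= (@conj_end_intertwine _ _ _ (a *: Tdiag a^-1 1)); last first.
- by rewrite !TdiagE weyl_swapE scale_sp4mx !mulr0 mulfV // (mulr1 a).
- exact: weyl_swapP.
(* The factor 1 gives every generator the scaled shape that [span3_scale] expects. *)
rewrite (@conj_end_intertwine _ _ _ (1 *: Xalpha_2beta F)); last first.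
- by rewrite scale1r !root_vectorsE weyl_swapE.
- exact: weyl_swapP.
rewrite (@conj_end_intertwine _ _ _ (1 *: Xalpha F)); last first.
- by rewrite scale1r !root_vectorsE weyl_swapE.
- exact: weyl_swapP.
by rewrite -/(span3 _ _ _) span3_scale ?oner_eq0 // span3C.
Qed.

Lemma principal_square g t : in_Sp4 g -> (conj_end g @: alg_principal F)%VS = t ->
  (forall E, E \in t -> lie_bracket (conj_end g (Tdiag 3 1)) E = 2 *: E -> E *m E = 0) ->
  False.
Proof.
move=> Sg gst sq0; pose N := Xalpha F + Xbeta F.
have [_ sN _] := mem_span3 (Tdiag 3 1) N (Xalpha_2beta F).
have N0 : N != 0.
  apply/eqP; rewrite /N !root_vectorsE add_sp4mx -sp4mx0 => /sp4mx_inj[_ _ /eqP].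
  by rewrite add0r oner_eq0.
have TN : lie_bracket (Tdiag 3 1) N = 2 *: N.
  rewrite /N !root_vectorsE add_sp4mx Tdiag_bracket scale_sp4mx.
  by congr sp4mx; ring.
have [gN gN0 gTN] := conj_eigenvector Sg gst sN TN N0.
have NN : N *m N != 0.
  (* The product E_12 E_24 contributes 1 to the upper right corner of the square. *)
  apply/eqP => /matrixP/(_ ord0 ord_max)/eqP.
  rewrite /N !root_vectorsE add_sp4mx mul_mx4 !mxE /=.
  by rewrite !(add0r, addr0, mulr0, mul0r, mulr1) oner_eq0.
case/eqP: NN; apply: (conj_end_inj Sg); rewrite linear0 -(sq0 _ gN gTN).
by rewrite !conj_endE !mulmxA mulmxKV //; case: Sg.
Qed.

(** A vector of weight 2 has no Cartan part, so in the short family it lies in the upper right block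
    and squares to zero. *)
Lemma principal_short_Nconj a : ~ Sp4_conjugate (alg_principal F) (fam_short a).
Proof.
move=> [g [Sg gst]]; apply: (principal_square Sg gst) => E.
have [sT _ _] := mem_span3 (Tdiag 3 1) (Xalpha F + Xbeta F) (Xalpha_2beta F).
have := memv_img (conj_end g) sT; rewrite gst => /fam_short_mem[c [q [r ->]]].
move=> /fam_short_mem[c' [q' [r' ->]]]; rewrite borelmx_bracket scale_borelmx.
case/borelmx_inj => -[_ /esym/eqP + _] _; rewrite mulf_eq0 pnatr_eq0 /= => /eqP->.
by rewrite -borelmx0 /borelmx /sp4mx; mx4_ring.
Qed.

End Inequivalence.

Theorem theorem7p2 (R : realType) :
  (forall s : {vspace 'M[R[i]]_4},
     sp4_subalgebra s -> \dim s = 3%N -> lie_solvable s ->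
     (exists X : 'M[R[i]]_4, X \in s /\ regular_semisimple X) ->
     ~ (exists h : {vspace 'M[R[i]]_4}, cartan_subalgebra h /\ (h <= s)%VS) ->
     [\/ exists a : R[i], admissible a /\ Sp4_conjugate s (fam_short a),
         exists a : R[i], admissible a /\ Sp4_conjugate s (fam_long a)
       | Sp4_conjugate s (alg_principal R[i])])
  /\ (forall a : R[i], admissible a ->
        Sp4_conjugate (fam_long a) (fam_long a^-1))
  /\ (forall a b : R[i], admissible a -> admissible b ->
        Sp4_conjugate (fam_short a) (fam_short b) -> a = b)
  /\ (forall a b : R[i], admissible a -> admissible b ->
        Sp4_conjugate (fam_long a) (fam_long b) -> a = b \/ a = b^-1)
  /\ (forall a b : R[i], admissible a -> admissible b ->
        ~ Sp4_conjugate (fam_short a) (fam_long b))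
  /\ (forall a : R[i], admissible a ->
        ~ Sp4_conjugate (fam_short a) (alg_principal R[i]))
  /\ (forall a : R[i], admissible a ->
        ~ Sp4_conjugate (fam_long a) (alg_principal R[i])).
Proof.
do ![split]; first exact: classification.
- by move=> a [/eqP a0 _ _]; apply: fam_long_inv.
- exact: fam_short_conj_eq.
- exact: fam_long_conj_eq.
- by move=> a b _ adm_b /Sp4_conjugate_sym; apply: fam_long_short_Nconj.
- by move=> a _ /Sp4_conjugate_sym; apply: principal_short_Nconj.
- exact: fam_long_principal_Nconj.
Qed.
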